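(* Let $({}_{f_2}M_1\times{}_{f_1}M_2,F)$ be a doubly warped product Finsler manifold. Then $(TM^\circ,\mathbf{G},\mathbf{J})$ is an almost Kählerian manifold.
   Context: A Finsler metric on a manifold $M$ is a function $F:TM\to[0,\infty)$ that is $C^\infty$ on the slit tangent bundle $TM^\circ$, positively $1$-homogeneous on fibres, and whose fibre Hessian of $\frac12F^2$ is positive definite. Let $(M_1,F_1)$, $(M_2,F_2)$ be Finsler manifolds and let $f_1:M_1\to\mathbb{R}^+$, $f_2:M_2\to\mathbb{R}^+$ be smooth. The doubly warped product Finsler manifold $({}_{f_2}M_1\times{}_{f_1}M_2,F)$ is $M=M_1\times M_2$ with $$F(v_1,v_2)=\sqrt{f_2^2(\pi_2(v_2))F_1^2(v_1)+f_1^2(\pi_1(v_1))F_2^2(v_2)},\qquad (v_1,v_2)\in TM^\circ:=TM_1^\circ\times TM_2^\circ,$$ where $\pi_1,\pi_2$ are the base-point projections. In induced coordinates $(\mathbf{x}^a,\mathbf{y}^a)$ on $TM$ put $\mathbf{g}_{ab}=\frac12\frac{\partial^2F^2}{\partial\mathbf{y}^a\partial\mathbf{y}^b}$ with inverse $\mathbf{g}^{ab}$, $\mathbf{G}^a=\frac14\mathbf{g}^{ab}\big(\frac{\partial^2F^2}{\partial\mathbf{y}^b\partial\mathbf{x}^c}\mathbf{y}^c-\frac{\partial F^2}{\partial\mathbf{x}^b}\big)$, $\mathbf{G}^a_b=\frac{\partial\mathbf{G}^a}{\partial\mathbf{y}^b}$, $\frac{\delta^d}{\delta^d\mathbf{x}^a}=\frac{\partial}{\partial\mathbf{x}^a}-\mathbf{G}^b_a\frac{\partial}{\partial\mathbf{y}^b}$,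 $\delta^d\mathbf{y}^a=d\mathbf{y}^a+\mathbf{G}^a_b\,d\mathbf{x}^b$ (the superscript $d$ is a label). The doubly warped Sasaki–Matsumoto metric is the Riemannian metric $\mathbf{G}=\mathbf{g}_{ab}\,d\mathbf{x}^a\otimes d\mathbf{x}^b+\mathbf{g}_{ab}\,\delta^d\mathbf{y}^a\otimes\delta^d\mathbf{y}^b$ on $TM^\circ$. The almost complex structure $\mathbf{J}$ on $TM^\circ$ is defined by $\mathbf{J}\big(\frac{\delta^d}{\delta^d\mathbf{x}^a}\big)=-\frac{\partial}{\partial\mathbf{y}^a}$, $\mathbf{J}\big(\frac{\partial}{\partial\mathbf{y}^a}\big)=\frac{\delta^d}{\delta^d\mathbf{x}^a}$. Almost Kählerian means: $\mathbf{G}(\mathbf{J}X,\mathbf{J}Y)=\mathbf{G}(X,Y)$ for all vector fields $X,Y$ on $TM^\circ$ (almost Hermitian), and the $2$-form $\Omega(X,Y)=\mathbf{G}(X,\mathbf{J}Y)$ is closed. *)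

(* Defs.v *)
From HB Require Import structures.
From mathcomp Require Import all_boot all_order all_algebra.
From mathcomp Require Import all_classical all_reals all_analysis.

Set Implicit Arguments.
Unset Strict Implicit.
Unset Printing Implicit Defensive.

Import Order.TTheory GRing.Theory Num.Theory.
Import numFieldNormedType.Exports.

Local Open Scope classical_set_scope.
Local Open Scope ring_scope.

Fixpoint Ck_on (R : realType) (n : nat) (V : normedModType R) (k : nat)
    (U : set 'rV[R]_n) (f : 'rV[R]_n -> V) : Prop :=
  match k with
  | 0 => forall x, U x -> {for x, continuous f}
  | k'.+1 => (forall x, U x -> differentiable f x) /\
             (forall a : 'I_n, Ck_on k' U ('D_(delta_mx 0 a) f))
  end.

(** Meant for open [U]: differentiability at a point of [U] is two-sided. *)
Definition smooth_on (R : realType) (n : nat) (V : normedModType R)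
    (U : set 'rV[R]_n) (f : 'rV[R]_n -> V) : Prop :=
  forall k : nat, Ck_on k U f.

(** The data of an atlas on a set.  Only the values of [coord i] on [dom i] and
    of [param i] on the image of [dom i] matter, [param i] being the inverse of
    [coord i] there.  [pref p] is a chosen chart around [p]: it witnesses that
    the charts cover, and the tangent space at [p] is modelled as R^dim by
    recording the components of a tangent vector in the chart [pref p].  The
    choice is arbitrary data, so a statement about all atlases holds for every
    choice. *)
Record atlas (R : realType) := Atlas {
  carrier :> Type ;
  dim : nat ;
  index : Type ;
  dom : index -> set carrier ;
  coord : index -> carrier -> 'rV[R]_dim ;
  param : index -> 'rV[R]_dim -> carrier ;
  pref : carrier -> index }.

Section Atlas.
Variables (R : realType) (A : atlas R).

Definition transition (i j : index A) : 'rV[R]_(dim A) -> 'rV[R]_(dim A) :=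
  coord j \o param i.

Definition chart_image (i : index A) (S : set A) : set 'rV[R]_(dim A) :=
  coord i @` (dom i `&` S).

(** For a manifold these are the open sets of the topology making all charts
    homeomorphisms onto open subsets of R^dim. *)
Definition atlas_open (S : set A) : Prop :=
  forall i, open (chart_image i S).

Record is_manifold : Prop := IsManifold {
  manifold_cover : forall p : A, dom (pref p) p ;
  manifold_paramK : forall (i : index A) (p : A), dom i p -> param i (coord i p) = p ;
  manifold_overlap : forall i j : index A, open (chart_image i (dom j)) ;
  manifold_transition : forall i j : index A,
    smooth_on (chart_image i (dom j)) (transition i j) ;
  manifold_hausdorff : forall p q : A, p <> q -> exists P Q : set A,
    [/\ atlas_open P, atlas_open Q, P p, Q q & P `&` Q = set0] ;
  manifold_second_countable : exists B : nat -> set A,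
    (forall k, atlas_open (B k)) /\
    (forall (P : set A) p, atlas_open P -> P p ->
       exists k, B k p /\ B k `<=` P) }.

(** Components in the chart [i] of the tangent vector [v] at [p]. *)
Definition tangent_comp (i : index A) (p : A) (v : 'rV[R]_(dim A)) :
    'rV[R]_(dim A) :=
  'd (transition (pref p) i) (coord (pref p) p) v.

(** The tangent vector at [param i x] whose components in the chart [i] are
    [u]. *)
Definition tangent_vec (i : index A) (x u : 'rV[R]_(dim A)) :
    'rV[R]_(dim A) :=
  'd (transition i (pref (param i x))) x u.

Definition smooth_fun (S : set A) (h : A -> R) : Prop :=
  forall i, smooth_on (chart_image i S) (h \o param i).

Definition smooth_vector_field (S : set A) (X : A -> 'rV[R]_(dim A)) : Prop :=
  forall i, smooth_on (chart_image i S)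
    (fun x => tangent_comp i (param i x) (X (param i x))).

Definition tensor2 : Type := A -> 'rV[R]_(dim A) -> 'rV[R]_(dim A) -> R.
Definition tensor_end : Type := A -> 'rV[R]_(dim A) -> 'rV[R]_(dim A).

Definition tensor2_comp (w : tensor2) (i : index A) (a b : 'I_(dim A))
    (x : 'rV[R]_(dim A)) : R :=
  w (param i x) (tangent_vec i x (delta_mx 0 a))
    (tangent_vec i x (delta_mx 0 b)).

Definition is_2form (S : set A) (w : tensor2) : Prop :=
  [/\ forall q, S q -> forall (t : R) X X' Y,
        w q (t *: X + X') Y = t * w q X Y + w q X' Y,
      forall q, S q -> forall X Y, w q X Y = - w q Y X &
      forall i a b, smooth_on (chart_image i S) (tensor2_comp w i a b)].

Definition d2form_comp (w : tensor2) (i : index A) (a b c : 'I_(dim A))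
    (x : 'rV[R]_(dim A)) : R :=
  'D_(delta_mx 0 a) (tensor2_comp w i b c) x +
  'D_(delta_mx 0 b) (tensor2_comp w i c a) x +
  'D_(delta_mx 0 c) (tensor2_comp w i a b) x.

Definition closed_2form (S : set A) (w : tensor2) : Prop :=
  is_2form S w /\
  forall i a b c x, chart_image i S x -> d2form_comp w i a b c x = 0.

Definition almost_hermitian (S : set A) (G : tensor2) (J : tensor_end) :
    Prop :=
  forall X Y, smooth_vector_field S X -> smooth_vector_field S Y ->
  forall q, S q -> G q (J q (X q)) (J q (Y q)) = G q (X q) (Y q).

(** The compatibility of [G] and [J] and the closedness of the fundamental form
    [G(X, J Y)]; that [G] is a metric and [J] an almost complex structure is a
    property of the data and not restated here. *)
Definition almost_kahler (S : set A) (G : tensor2) (J : tensor_end) : Prop :=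
  almost_hermitian S G J /\ closed_2form S (fun q X Y => G q X (J q Y)).

(** The tangent bundle, with the induced coordinates [row_mx x y]. *)
Definition tangent : atlas R := {|
  carrier := (carrier A * 'rV[R]_(dim A))%type ;
  dim := (dim A + dim A)%N ;
  index := index A ;
  dom := fun i => [set q | dom i q.1] ;
  coord := fun i q => row_mx (coord i q.1) (tangent_comp i q.1 q.2) ;
  param := fun i z =>
    (param i (lsubmx z), tangent_vec i (lsubmx z) (rsubmx z)) ;
  pref := fun q => pref q.1 |}.

Definition slit : set tangent := [set q | q.2 != 0].

End Atlas.

Arguments slit {R} A _.

(** [pref] being componentwise, the tangent space of the product at [(p1, p2)]
    is the direct sum of those of the factors, through [row_mx]. *)
Definition product (R : realType) (A1 A2 : atlas R) : atlas R := {|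
  carrier := (carrier A1 * carrier A2)%type ;
  dim := (dim A1 + dim A2)%N ;
  index := (index A1 * index A2)%type ;
  dom := fun i => [set p | dom i.1 p.1 /\ dom i.2 p.2] ;
  coord := fun i p => row_mx (coord i.1 p.1) (coord i.2 p.2) ;
  param := fun i x => (param i.1 (lsubmx x), param i.2 (rsubmx x)) ;
  pref := fun p => (pref p.1, pref p.2) |}.

Section Finsler.
Variables (R : realType) (A : atlas R) (F : tangent A -> R).

Definition dx (a : 'I_(dim A)) : 'rV[R]_(dim A + dim A) :=
  row_mx (delta_mx 0 a) 0.
Definition dy (a : 'I_(dim A)) : 'rV[R]_(dim A + dim A) :=
  row_mx 0 (delta_mx 0 a).

Definition sqF (i : index A) (z : 'rV[R]_(dim A + dim A)) : R :=
  F (@param R (tangent A) i z) ^+ 2.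

Definition fundamental (i : index A) (z : 'rV[R]_(dim A + dim A)) :
    'M[R]_(dim A) :=
  \matrix_(a, b) (2^-1 * 'D_(dy a) ('D_(dy b) (sqF i)) z).

Definition spray (i : index A) (a : 'I_(dim A))
    (z : 'rV[R]_(dim A + dim A)) : R :=
  4^-1 * \sum_b invmx (fundamental i z) a b *
    ((\sum_c 'D_(dy b) ('D_(dx c) (sqF i)) z * rsubmx z 0 c)
     - 'D_(dx b) (sqF i) z).

Definition connection (i : index A) (z : 'rV[R]_(dim A + dim A))
    (a b : 'I_(dim A)) : R :=
  'D_(dy b) (spray i a) z.

Definition delta_x (i : index A) (z : 'rV[R]_(dim A + dim A))
    (a : 'I_(dim A)) : 'rV[R]_(dim A + dim A) :=
  dx a - \sum_b connection i z b a *: dy b.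

Definition delta_y (i : index A) (z : 'rV[R]_(dim A + dim A))
    (a : 'I_(dim A)) (X : 'rV[R]_(dim A + dim A)) : R :=
  rsubmx X 0 a + \sum_b connection i z a b * lsubmx X 0 b.

(** A tangent vector at [q] is given by its components in the induced chart
    [pref q], so the coordinate formulas below are those of that chart. *)
Definition sasaki_matsumoto : tensor2 (tangent A) := fun q X Y =>
  let i := @pref R (tangent A) q in
  let z := @coord R (tangent A) i q in
  \sum_a \sum_b fundamental i z a b * (lsubmx X 0 a * lsubmx Y 0 b) +
  \sum_a \sum_b fundamental i z a b * (delta_y i z a X * delta_y i z b Y).

(** The linear map with J(delta_x a) = - dy a and J(dy a) = delta_x a, written
    with the coframe (dx^a, delta_y a) dual to the frame (delta_x a, dy a). *)
Definition complex_structure : tensor_end (tangent A) := fun q X =>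
  let i := @pref R (tangent A) q in
  let z := @coord R (tangent A) i q in
  \sum_a lsubmx X 0 a *: - dy a + \sum_a delta_y i z a X *: delta_x i z a.

Record is_finsler : Prop := IsFinsler {
  finsler_ge0 : forall q, 0 <= F q ;
  finsler_smooth : @smooth_fun R (tangent A) (slit A) F ;
  finsler_homogeneous : forall (p : A) (v : 'rV[R]_(dim A)) (t : R),
    0 < t -> F (p, t *: v) = t * F (p, v) ;
  finsler_convex : forall (i : index A) z,
    @chart_image R (tangent A) i (slit A) z ->
    forall u : 'rV[R]_(dim A), u != 0 ->
    0 < \sum_a \sum_b fundamental i z a b * (u 0 a * u 0 b) }.

End Finsler.

(** The bundle TM1° x TM2°, an open subset of T(M1 x M2). *)
Definition slit_product (R : realType) (M1 M2 : atlas R) :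
    set (tangent (product M1 M2)) :=
  [set q | lsubmx (q.2 : 'rV[R]_(dim M1 + dim M2)) != 0 /\
           rsubmx (q.2 : 'rV[R]_(dim M1 + dim M2)) != 0].
Arguments slit_product {R} M1 M2 _.

Definition doubly_warped (R : realType) (M1 M2 : atlas R)
    (F1 : tangent M1 -> R) (F2 : tangent M2 -> R)
    (f1 : M1 -> R) (f2 : M2 -> R) : tangent (product M1 M2) -> R :=
  fun q =>
    let v : 'rV[R]_(dim M1 + dim M2) := q.2 in
    Num.sqrt (f2 q.1.2 ^+ 2 * F1 (q.1.1, lsubmx v) ^+ 2 +
              f1 q.1.1 ^+ 2 * F2 (q.1.2, rsubmx v) ^+ 2).

(* Main.v *)
(** In every induced chart the form [G(X, J Y)] is minus the exterior derivative
    of the Hilbert form [theta = 1/2 dF^2/dy^a dx^a].  Indeed the term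
    [g_ab N^b_c - g_cb N^b_a] coming from the connection is found by
    differentiating the lowered spray [g_ab G^b], and it is the antisymmetrized
    mixed second derivative of [F^2 / 2].  As [theta] is natural under the maps
    [(x, y) |-> (phi x, dphi_x y)], these local expressions agree on all charts,
    and the form is smooth and closed because partial derivatives commute.  On
    the doubly warped product it remains to see that [F^2] is smooth and that
    [g], which is block diagonal, is invertible.  The compatibility of [G] and
    [J] is linear algebra in the adapted frame. *)
Require Import Defs.
From HB Require Import structures.
From mathcomp Require Import all_boot all_order all_algebra.
From mathcomp Require Import all_classical all_reals all_analysis.
From mathcomp Require Import perm ring.

Import Order.TTheory GRing.Theory Num.Theory.
Import numFieldNormedType.Exports.

Local Open Scope classical_set_scope.
Local Open Scope ring_scope.

Set Implicit Arguments.
Unset Strict Implicit.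
Unset Printing Implicit Defensive.

(** * Directional derivatives *)

(** The metric and [J] at a point are written in the chart [pref] of that point, and this choice may
    jump from point to point. Neither smoothness nor closedness can therefore be read off their
    formulas. The remedy is to move the form, one point at a time, to a fixed chart; the resulting
    components involve only derivatives of [F^2] in that chart, and these may be differentiated.
    Since the connection coefficients have disappeared by then, the inverse matrix of [g] is only
    ever required to be differentiable, and its derivative is never evaluated. Working with [F^2]
    removes the square root, leaving a sum of products that is smooth where both fibre components
    are nonzero. Invertibility of [g] comes from its quadratic form, a second derivative along a
    vertical vector, so that no block matrix has to be written down. *)

Section DirectionalDerivatives.
Variable R : realType.

(** The zero map satisfies the first-order expansion at [x], so [diff_unique] identifies it with the
    differential. Added to [f] as the difference [g - f], such a function shows below that
    differentiability is a local property. *)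
Lemma differentiable_near0 (V W : normedModType R) (f : V -> W) (x : V) :
  (\near x, f x = 0) -> differentiable f x.
Proof.
move=> f0.
have E : f \o shift x = cst (f x) + (\0 : V -> W) +o_ (0 : V) id.
  apply/eqaddoP => e e0.
  move: (f0); rewrite (near_shift 0) subr0; apply: filterS => h /= fh.
  rewrite !fctE /= fh.
  by rewrite (nbhs_singleton f0) /= addr0 subr0 normr0 mulr_ge0 // ltW.
have c0 : continuous (\0 : V -> W) by move=> ?; apply: cst_continuous.
by apply/diff_locallyP; rewrite (diff_unique c0 E).
Qed.

Lemma near_eq_differentiable (V W : normedModType R) (f g : V -> W) (x : V) :
  (\near x, f x = g x) -> differentiable f x -> differentiable g x.
Proof.
move=> fg df.
have -> : g = f + (g - f) by rewrite addrC subrK.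
apply: (differentiableD df); apply: differentiable_near0.
by apply: filterS fg => y /= fgy; rewrite !fctE fgy subrr.
Qed.

Lemma near_eq_diff (V W : normedModType R) (f g : V -> W) (x u : V) :
  (\near x, f x = g x) -> differentiable f x -> 'd f x u = 'd g x u.
Proof.
move=> fg df; rewrite -!deriveE //; first exact: near_eq_derive.
exact: near_eq_differentiable df.
Qed.

Lemma open_near (T : topologicalType) (U : set T) (P : T -> Prop) (x : T) :
  open U -> U x -> (forall y, U y -> P y) -> \near x, P x.
Proof. by move=> oU Ux UP; apply: filterS (open_nbhs_nbhs (conj oU Ux)). Qed.

Lemma near_eq_continuous (T U : topologicalType) (f g : T -> U) (x : T) :
  (\near x, f x = g x) -> f @ x --> f x -> g @ x --> g x.
Proof.
move=> fg; rewrite -(nbhs_singleton fg); apply: cvg_trans; exact: near_eq_cvg.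
Qed.

Lemma derive_line (V W : normedModType R) (f : V -> W) (y v : V) (t : R) :
  derivable f (t *: v + y) v ->
  is_derive t 1 (fun s : R => f (s *: v + y)) ('D_v f (t *: v + y)).
Proof.
move=> df.
have E : (fun h : R => h^-1 *: (f ((h *: 1 + t) *: v + y) - f (t *: v + y))) =
   (fun h : R => h^-1 *: (f (h *: v + (t *: v + y)) - f (t *: v + y))).
  by apply/funext => h; rewrite scalerDl addrA /GRing.scale /= mulr1.
by apply: DeriveDef; rewrite /derivable /derive /= E.
Qed.

Lemma MVT_line (V : normedModType R) (f : V -> R) (y v : V) (h : R) :
  0 < h -> (forall t, 0 <= t <= h -> derivable f (t *: v + y) v) ->
  exists2 c, 0 < c < h & f (h *: v + y) - f y = h * 'D_v f (c *: v + y).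
Proof.
move=> h0 df.
have [||c] := @MVT R (fun s => f (s *: v + y)) (fun s => 'D_v f (s *: v + y)) 0
  h h0.
- move=> x; rewrite in_itv /= => /andP[x0 xh].
  by apply/derive_line/df; rewrite !ltW.
- apply: derivable_within_continuous => x; rewrite in_itv /= => xh.
  by have [] := derive_line (df x xh).
rewrite in_itv /= => ch E; exists c => //.
by move: E; rewrite scale0r add0r subr0 mulrC.
Qed.

(** The mean value theorem is applied twice: along [v] to the increment [g] of [f] in the direction
    [h *: u], then along [u] to ['D_v f]. *)
Lemma second_difference (V : normedModType R) (f : V -> R) (y u v : V) (h : R) :
  0 < h ->
  (forall s t, 0 <= s <= h -> 0 <= t <= h ->
     derivable f (s *: u + (t *: v + y)) v /\
     derivable ('D_v f) (s *: u + (t *: v + y)) u) ->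
  exists c d, [/\ 0 < c < h, 0 < d < h &
    f (h *: u + (h *: v + y)) - f (h *: v + y) - (f (h *: u + y) - f y) =
    h * (h * 'D_u ('D_v f) (d *: u + (c *: v + y)))].
Proof.
move=> h0 df.
have h00 : (0 : R) <= 0 <= h by rewrite lexx ltW.
have hh : 0 <= h <= h by rewrite lexx ltW.
pose g z := f (h *: u + z) - f z.
have dg t : 0 <= t <= h -> is_derive (t *: v + y) v g
    ('D_v f (h *: u + (t *: v + y)) - 'D_v f (t *: v + y)).
  move=> th; apply: is_deriveB.
    have [D _] := df h t hh th.
    pose z := t *: v + y.
    have E : (fun k : R =>
      k^-1 *: (f (h *: u + (k *: v + z)) - f (h *: u + z))) =
        (fun k : R => k^-1 *: (f (k *: v + (h *: u + z)) - f (h *: u + z))).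
      by apply/funext => k; congr (_ *: (f _ - _)); rewrite addrCA.
    by apply: DeriveDef; rewrite /derivable /derive /= E.
  have [D _] := df 0 t h00 th.
  by move: D; rewrite scale0r add0r => /derivableP.
have [|c ch] := @MVT_line _ g y v h h0.
  by move=> t /dg[].
have /dg[_ ->] : 0 <= c <= h by case/andP: ch => ? ?; rewrite !ltW.
have [|d dh ->] := @MVT_line _ ('D_v f) (c *: v + y) u h h0.
  by move=> t th; apply: (df t c th _).2; case/andP: ch => ? ?; rewrite !ltW.
by move=> E; exists c, d.
Qed.

Lemma ge_min_l (a b : R) : Num.min a b <= a.
Proof. by rewrite ge_min lexx. Qed.

Lemma ge_min_r (a b : R) : Num.min a b <= b.
Proof. by rewrite ge_min lexx orbT. Qed.

(** The points [y] and [z] may differ, since the two orders of differentiation give unrelated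
    intermediate points. *)
Lemma cvg_eq_nearby (V : normedModType R) (p q : V -> R) (x : V) :
  p @ x --> p x -> q @ x --> q x ->
  (forall r, 0 < r -> exists y z, [/\ ball x r y, ball x r z & p y = q z]) ->
  p x = q x.
Proof.
move=> cp cq pq; apply/eqP; rewrite -subr_eq0 -normr_le0.
apply/ler_addgt0Pl => e e0; rewrite addr0.
have e20 : 0 < e / 2 by rewrite divr_gt0.
move/cvgrPdist_le: cp => /(_ _ e20) /nbhs_ballP[r1 /= r10 H1].
move/cvgrPdist_le: cq => /(_ _ e20) /nbhs_ballP[r2 /= r20 H2].
have [|y [z [xy xz E]]] := pq (Num.min r1 r2); first by rewrite lt_min r10.
have {}H1 := H1 y (le_ball (ge_min_l _ _) xy).
have {}H2 := H2 z (le_ball (ge_min_r _ _) xz).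
rewrite (splitr e) (le_trans _ (lerD H1 H2)) //= E [`|q x - _|]distrC.
by rewrite (le_trans _ (ler_normD _ _)) // addrA subrK.
Qed.

(** By the mean value theorem in either order, both mixed derivatives are
    approximated by the second difference of [f] over a small parallelogram. *)
Lemma derive_comm (V : normedModType R) (f : V -> R) (x u v : V) :
  (\near x, [/\ derivable f x u, derivable f x v,
     derivable ('D_u f) x v & derivable ('D_v f) x u]) ->
  'D_u ('D_v f) @ x --> 'D_u ('D_v f) x ->
  'D_v ('D_u f) @ x --> 'D_v ('D_u f) x ->
  'D_u ('D_v f) x = 'D_v ('D_u f) x.
Proof.
move=> /nbhs_ballP[r /= r0 df] cuv cvu;
  apply: cvg_eq_nearby cuv cvu _ => r' r'0.
(* With this [M] the parallelogram of side [h] stays within distance [h * M = rm / 2] of [x]; the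
   summand 1 keeps [M] positive when [u] and [v] vanish. *)
pose M := `|u| + `|v| + 1.
have M0 : 0 < M by rewrite ltr_wpDl // addr_ge0.
pose rm := Num.min r r'.
have rm0 : 0 < rm by rewrite lt_min r0.
pose h := rm / 2 / M.
have h0 : 0 < h by rewrite !divr_gt0.
have near_x s t : 0 <= s <= h -> 0 <= t <= h ->
  ball x rm (s *: u + (t *: v + x)).
  move=> /andP[s0 sh] /andP[t0 th].
  rewrite -ball_normE /= addrA opprD addrCA subrr addr0 normrN.
  apply: le_lt_trans (ler_normD _ _) _; rewrite !normrZ !ger0_norm //.
  apply: (@le_lt_trans _ _ (h * M)); last first.
    by rewrite /h divfK ?gt_eqF // ltr_pdivrMr // mulr_natr mulr2n ltrDl.
  rewrite /M mulrDr mulr1 mulrDr ler_wpDr //; first exact: ltW.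
  by rewrite lerD // ler_wpM2r.
have dfx s t sh th := df _ (le_ball (ge_min_l _ _) (near_x s t sh th)).
have [|c [d [ch dh E1]]] := @second_difference _ f x u v h h0.
  by move=> s t sh th; have [_ D1 _ D2] := dfx _ _ sh th; exact: (conj D1 D2).
have [|c' [d' [c'h d'h E2]]] := @second_difference _ f x v u h h0.
  by move=> s t sh th; rewrite addrCA; have [D1 _ D2 _] := dfx _ _ th sh;
    exact: (conj D1 D2).
have bx s t : 0 < s < h -> 0 < t < h -> ball x r' (s *: u + (t *: v + x)).
  move=> /andP[s0 sh] /andP[t0 th].
  by apply: (le_ball (ge_min_r r r')); apply: near_x; rewrite !ltW.
exists (d *: u + (c *: v + x)), (d' *: v + (c' *: u + x)); split.
- exact: bx.
- by rewrite addrCA; exact: bx.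
have alg (k1 k2 k3 k4 P Q : R) : k1 - k2 - (k3 - k4) = h * (h * P) ->
    k1 - k3 - (k2 - k4) = h * (h * Q) -> P = Q.
  move=> EP EQ; apply: (mulfI (lt0r_neq0 h0)); apply: (mulfI (lt0r_neq0 h0)).
  by rewrite -EP -EQ; ring.
rewrite [h *: v + (h *: u + x)]addrCA in E2.
exact: alg E1 E2.
Qed.

End DirectionalDerivatives.

(** * Functions of class C^k on an open set *)

Section Ck.
Variables (R : realType) (n : nat).
Implicit Types (U : set 'rV[R]_n) (x : 'rV[R]_n).

Lemma derive_basis (V : normedModType R) (f : 'rV[R]_n -> V) x (v : 'rV[R]_n) :
  differentiable f x ->
  'D_v f x = \sum_a v 0 a *: 'D_(delta_mx 0 a) f x.
Proof.
move=> df; rewrite (deriveE _ df) {1}[v]row_sum_delta linear_sum.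
by apply: eq_bigr => a _; rewrite linearZ (deriveE _ df).
Qed.

Lemma Ck_onW (V : normedModType R) k U (f : 'rV[R]_n -> V) :
  Ck_on k.+1 U f -> Ck_on k U f.
Proof.
elim: k f => [|k IH] f [df Df].
  by move=> x Ux; exact: (differentiable_continuous (df _ Ux)).
by split=> // a; apply: IH; exact: Df.
Qed.

Lemma Ck_on_subset (V : normedModType R) k U U' (f : 'rV[R]_n -> V) :
  U' `<=` U -> Ck_on k U f -> Ck_on k U' f.
Proof.
move=> UU'; elim: k f => [|k IH] f /=; first by move=> H x /UU'; apply: H.
by move=> [df Df]; split=> [x /UU'|a]; [apply: df|apply: IH; exact: Df].
Qed.

Lemma Ck_on_ext (V : normedModType R) k U (f g : 'rV[R]_n -> V) :
  open U -> (forall x, U x -> f x = g x) -> Ck_on k U f -> Ck_on k U g.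
Proof.
move=> oU; elim: k f g => [|k IH] f g fg /=.
  move=> H x Ux; apply: (near_eq_continuous (open_near oU Ux fg)); exact: H.
move=> [df Df]; split=> [x Ux|a].
  exact: near_eq_differentiable (open_near oU Ux fg) (df x Ux).
apply: IH (Df a) => x Ux.
exact: near_eq_derive (open_near oU Ux fg).
Qed.

Lemma Ck_on_cst (V : normedModType R) k U (c : V) : Ck_on k U (fun=> c).
Proof.
elim: k c => [|k IH] c /=; first by move=> x _; exact: cst_continuous.
split=> [x _|a]; first exact: differentiable_cst.
have -> : 'D_(delta_mx 0 a : 'rV[R]_n) (fun=> c) = (fun=> (0 : V)).
  by apply: funext => x; exact: derive_cst.
exact: IH.
Qed.

Lemma Ck_on_D (V : normedModType R) k U (f g : 'rV[R]_n -> V) :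
  open U -> Ck_on k U f -> Ck_on k U g -> Ck_on k U (fun x => f x + g x).
Proof.
move=> oU; elim: k f g => [|k IH] f g /=.
  by move=> cf cg x Ux; exact: (@cvgD _ _ _ _ _ f g _ _ (cf _ Ux) (cg _ Ux)).
move=> [df Df] [dg Dg]; split=> [x Ux|a].
  exact: differentiableD (df _ Ux) (dg _ Ux).
apply: Ck_on_ext (IH _ _ (Df a) (Dg a)) => // x Ux.
rewrite -[RHS]/('D_(delta_mx 0 a) (f + g) x).
by rewrite (deriveD (diff_derivable (df _ Ux)) (diff_derivable (dg _ Ux))).
Qed.

Lemma Ck_on_M k U (f g : 'rV[R]_n -> R) :
  open U -> Ck_on k U f -> Ck_on k U g -> Ck_on k U (fun x => f x * g x).
Proof.
move=> oU; elim: k f g => [|k IH] f g.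
  by move=> cf cg x Ux; exact: (@cvgM _ _ _ _ f g _ _ (cf _ Ux) (cg _ Ux)).
move=> Cf Cg; have [df Df] := Cf; have [dg Dg] := Cg; split=> [x Ux|a].
  exact: differentiableM (df _ Ux) (dg _ Ux).
have C1 := IH _ _ (Ck_onW Cf) (Dg a).
have C2 := IH _ _ (Ck_onW Cg) (Df a).
apply: Ck_on_ext (Ck_on_D oU C1 C2) => // x Ux.
rewrite -[RHS]/('D_(delta_mx 0 a) (f * g) x).
by rewrite (deriveM (diff_derivable (df _ Ux)) (diff_derivable (dg _ Ux))).
Qed.

Lemma Ck_on_sum (V : normedModType R) k U m (f : 'I_m -> 'rV[R]_n -> V) :
  open U -> (forall i, Ck_on k U (f i)) -> Ck_on k U (fun x => \sum_i f i x).
Proof.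
move=> oU; elim: m f => [|m IH] f Cf.
  apply: Ck_on_ext (Ck_on_cst k U (0 : V)) => // x _.
  by rewrite big_ord0.
apply: Ck_on_ext (Ck_on_D oU (Cf ord0) (IH _ (fun i => Cf (lift ord0 i)))) =>
  // x _.
by rewrite big_ord_recl.
Qed.

Lemma derive_coord m (f : 'rV[R]_n -> 'rV[R]_m) x v b :
  differentiable f x -> 'D_v (fun y => f y 0 b) x = 'D_v f x 0 b.
Proof. by move=> /diff_derivable df; rewrite derive_mx // mxE. Qed.

Lemma differentiable_comp_coord m (f : 'rV[R]_n -> 'rV[R]_m) x b :
  differentiable f x -> differentiable (fun y => f y 0 b) x.
Proof.
move=> df; exact: (differentiable_comp df (differentiable_coord (f x) 0 b)).
Qed.

Lemma Ck_on_coord k U m (f : 'rV[R]_n -> 'rV[R]_m) b :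
  open U -> Ck_on k U f -> Ck_on k U (fun x => f x 0 b).
Proof.
move=> oU; elim: k f => [|k IH] f.
  move=> cf x Ux;
    apply: (@continuous_comp _ _ _ f (fun y : 'rV_m => y 0 b) x) => //.
    exact: cf.
  exact: coord_continuous.
move=> [df Df]; split=> [x Ux|a];
  first exact: differentiable_comp_coord (df _ Ux).
apply: Ck_on_ext (IH _ (Df a)) => // x Ux.
by rewrite derive_coord //; exact: df.
Qed.

(** [Ck_on] records derivatives along the standard basis only; any other direction is a combination
    of these with constant coefficients. *)
Lemma Ck_on_derive k U (f : 'rV[R]_n -> R) v :
  open U -> Ck_on k.+1 U f -> Ck_on k U ('D_v f).
Proof.
move=> oU [df Df].
have C : Ck_on k U (fun x => \sum_a v 0 a * 'D_(delta_mx 0 a) f x).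
  apply: Ck_on_sum => // a; apply: Ck_on_M => //; first exact: Ck_on_cst.
  exact: Df.
by apply: Ck_on_ext C => // x Ux; rewrite (derive_basis _ (df _ Ux)).
Qed.

Lemma Ck_on_rV k U m (f : 'rV[R]_n -> 'rV[R]_m) :
  open U -> (forall b, Ck_on k U (fun x => f x 0 b)) -> Ck_on k U f.
Proof.
move=> oU; elim: k f => [|k IH] f Cf.
  have -> : f = fun y => \sum_b f y 0 b *: delta_mx 0 b by apply/funext => y;
    exact: row_sum_delta.
  apply: Ck_on_sum => // b x Ux.
  have cf : (fun y => f y 0 b) @ x --> f x 0 b := Cf b x Ux.
  exact: cvgZr_tmp cf.
have df x : U x -> differentiable f x.
  move=> Ux; have -> : f = \sum_b (fun y => f y 0 b *: delta_mx 0 b).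
    by apply/funext => y; rewrite fct_sumE; exact: row_sum_delta.
  by apply: differentiable_sum => b; exact: differentiableZl ((Cf b).1 x Ux).
split=> // a; apply: IH => b; apply: Ck_on_ext ((Cf b).2 a) => // x Ux.
by rewrite derive_coord //; exact: df.
Qed.

Lemma Ck_on_derive_comm U (f : 'rV[R]_n -> R) x a b :
  open U -> U x -> Ck_on 2 U f ->
  'D_(delta_mx 0 a) ('D_(delta_mx 0 b) f) x =
    'D_(delta_mx 0 b) ('D_(delta_mx 0 a) f) x.
Proof.
move=> oU Ux [df Df]; apply: derive_comm.
- apply: (open_near oU Ux) => y Uy; split; apply: diff_derivable.
  + exact: df.
  + exact: df.
  + exact: (Df a).1.
  + exact: (Df b).1.
- exact: (Df b).2 a x Ux.
- exact: (Df a).2 b x Ux.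
Qed.

End Ck.

(** * Composition with linear maps *)

Section LinearSubstitution.
Variables (R : realType) (n : nat).

(** Finite dimension of the source is what makes this true: [L] is a finite sum of coordinate
    functions times constant vectors. *)
Lemma differentiable_linear_rV (V : normedModType R) (L : 'rV[R]_n -> V) x :
  linear L -> differentiable L x.
Proof.
move=> linL; pose linLB := GRing.isLinear.Build _ _ _ _ _ linL.
pose L' : {linear 'rV[R]_n -> V} := HB.pack L linLB.
have -> : L = \sum_b (fun y : 'rV[R]_n => y 0 b *: L (delta_mx 0 b)).
  apply/funext => y;
    rewrite fct_sumE {1}[y]row_sum_delta -[L]/(L' : _ -> _) linear_sum.
  by apply: eq_bigr => b _; rewrite linearZ.
by apply: differentiable_sum => b;
  exact: differentiableZl (differentiable_coord _ _ _).
Qed.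

Lemma diff_linear_rV (V : normedModType R) (L : 'rV[R]_n -> V) x u :
  linear L -> 'd L x u = L u.
Proof.
move=> linL; pose linLB := GRing.isLinear.Build _ _ _ _ _ linL.
pose L' : {linear 'rV[R]_n -> V} := HB.pack L linLB.
have cL : continuous L' by move=> y;
  exact: differentiable_continuous (differentiable_linear_rV y linL).
exact: (f_equal (fun f => f u) (diff_lin x cL)).
Qed.

Lemma derive_comp_linear (W : normedModType R) m (L : 'rV[R]_n -> 'rV[R]_m)
    (h : 'rV[R]_m -> W) z u :
  linear L -> differentiable h (L z) -> 'D_u (h \o L) z = 'D_(L u) h (L z).
Proof.
move=> linL dh; have dL := differentiable_linear_rV z linL.
rewrite (deriveE _ (differentiable_comp dL dh)) (deriveE _ dh).
by rewrite (diff_comp dL dh) /= diff_linear_rV.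
Qed.

Lemma Ck_on_comp_linear m k (U : set 'rV[R]_m) (f : 'rV[R]_m -> R)
    (L : 'rV[R]_n -> 'rV[R]_m) :
  open U -> linear L -> Ck_on k U f -> Ck_on k (L @^-1` U) (f \o L).
Proof.
move=> oU linL; have dL x := differentiable_linear_rV x linL.
have oLU : open (L @^-1` U).
  by apply: open_comp oU => x _; exact: differentiable_continuous (dL x).
elim: k f => [|k IH] f Cf.
  move=> x Ux; apply: continuous_comp; last exact: Cf.
  exact: differentiable_continuous (dL x).
have [df Df] := Cf.
split=> [x Ux|a]; first exact: (differentiable_comp (dL x) (df _ Ux)).
have C : Ck_on k (L @^-1` U)
   (fun x => \sum_b L (delta_mx 0 a) 0 b * ('D_(delta_mx 0 b) f \o L) x).
  apply: Ck_on_sum => // b; apply: Ck_on_M => //; first exact: Ck_on_cst.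
  by apply: IH; exact: Df.
apply: Ck_on_ext C => // x Ux.
by rewrite (derive_comp_linear _ linL (df _ Ux)) (derive_basis _ (df _ Ux)).
Qed.

End LinearSubstitution.

(** * Sums, determinants and two algebraic expansions *)

Section SumsAndProducts.
Variables (R : realType) (V : normedModType R).

Lemma differentiable_bigsum (W : normedModType R) (I : Type) (r : seq I)
    (f : I -> V -> W) (x : V) :
  (forall i, differentiable (f i) x) ->
  differentiable (fun y => \sum_(i <- r) f i y) x.
Proof.
move=> df; elim: r => [|i r IH].
  have -> : (fun y => \sum_(i <- [::]) f i y) = cst 0 by apply/funext => y;
    rewrite big_nil.
  exact: differentiable_cst.
have -> : (fun y => \sum_(j <- i :: r) f j y) = f i +
  (fun y => \sum_(j <- r) f j y).
  by apply/funext => y; rewrite big_cons.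
exact: differentiableD (df i) IH.
Qed.

Lemma differentiable_bigprod (I : Type) (r : seq I) (f : I -> V -> R) (x : V) :
  (forall i, differentiable (f i) x) ->
  differentiable (fun y => \prod_(i <- r) f i y) x.
Proof.
move=> df; elim: r => [|i r IH].
  have -> : (fun y => \prod_(i <- [::]) f i y) = cst 1 by apply/funext => y;
    rewrite big_nil.
  exact: differentiable_cst.
have -> : (fun y => \prod_(j <- i :: r) f j y) =
  f i * (fun y => \prod_(j <- r) f j y).
  by apply/funext => y; rewrite big_cons.
exact: differentiableM (df i) IH.
Qed.

Lemma differentiable_det n (M : V -> 'M[R]_n) (x : V) :
  (forall a b, differentiable (fun y => M y a b) x) ->
  differentiable (fun y => \det (M y)) x.
Proof.
move=> dM; apply: differentiable_bigsum => s.
have dp := @differentiable_bigprod _ (index_enum 'I_n) (fun i y => M y i (s i))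
  x (fun i => dM i (s i)).
exact: (differentiableM (differentiable_cst ((-1) ^+ s : R) x) dp).
Qed.

(** Cramer's rule: the entries of the adjugate and the determinant are polynomials in the entries of
    the matrix. *)
Lemma differentiable_invmx n (M : V -> 'M[R]_n) (x : V) a b :
  (forall a b, differentiable (fun y => M y a b) x) ->
  (\near x, M x \in unitmx) ->
  differentiable (fun y => invmx (M y) a b) x.
Proof.
move=> dM uM.
have dadj : differentiable (fun y => (\adj (M y)) a b) x.
  have -> : (fun y => (\adj (M y)) a b) =
      (fun=> (-1) ^+ (b + a)) * (fun y => \det (row' b (col' a (M y)))).
    by apply/funext => y; rewrite mxE.
  apply: differentiableM; first exact: differentiable_cst.
  apply: differentiable_det => c e.
  by under eq_fun do rewrite !mxE; exact: dM.
have det0 : \det (M x) != 0.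
  by have := nbhs_singleton uM; rewrite unitmxE unitfE.
(* [invmx] returns its argument on singular matrices, so the adjugate formula is available only near
   [x]. *)
apply: near_eq_differentiable
  (differentiableM (differentiableV (differentiable_det dM) det0) dadj).
by apply: filterS uM => y uy; rewrite /invmx uy fctE !mxE.
Qed.

Lemma derive_bigsum n (f : 'I_n -> V -> R) (x v : V) :
  (forall i, differentiable (f i) x) ->
  'D_v (fun y => \sum_i f i y) x = \sum_i 'D_v (f i) x.
Proof.
move=> df.
have -> : (fun y => \sum_i f i y) = \sum_i f i by apply/funext => y;
  rewrite fct_sumE.
by rewrite derive_sum // => i; exact: diff_derivable (df i).
Qed.

Lemma derive_sumM n (f g : 'I_n -> V -> R) (x v : V) :
  (forall i, differentiable (f i) x) -> (forall i, differentiable (g i) x) ->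
  'D_v (fun y => \sum_i f i y * g i y) x =
  \sum_i (f i x * 'D_v (g i) x + g i x * 'D_v (f i) x).
Proof.
move=> df dg; rewrite derive_bigsum; last by move=> i;
  exact: differentiableM (df i) (dg i).
by apply: eq_bigr => i _;
  exact: deriveM (diff_derivable (df i)) (diff_derivable (dg i)).
Qed.

End SumsAndProducts.

(** Here [x], [u] and [y], [v] are the base and fibre components of two tangent vectors [X] and [Y],
    and [P c a] plays the derivative of the Hilbert coefficient of index [a] along the base
    coordinate [c]. The left side is [G(X, J Y)], the right side [omega]. After renaming indices the
    coefficients [N] occur only in the antisymmetric combination that the second hypothesis
    expresses through [P]. *)
Lemma lowered_form_expand (R : comPzRingType) n (g N P : 'I_n -> 'I_n -> R)
    (x u y v : 'I_n -> R) :
  (forall a b, g a b = g b a) ->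
  (forall a c, \sum_b (g a b * N b c - g c b * N b a) = P c a - P a c) ->
  \sum_a \sum_b g a b * (x a * (v b + \sum_c N b c * y c)
                         - (u a + \sum_c N a c * x c) * y b) =
  \sum_a ((\sum_c y c * P c a + \sum_b v b * g b a) * x a
          - (\sum_c x c * P c a + \sum_b u b * g b a) * y a).
Proof.
move=> gC gN.
transitivity (\sum_a \sum_b (g a b * (x a * v b - u a * y b) +
  (P b a - P a b) * (x a * y b))).
  transitivity (\sum_a \sum_b g a b * (x a * v b - u a * y b) +
    (\sum_a \sum_b \sum_c g a b * N b c * (x a * y c) -
     \sum_a \sum_b \sum_c g a b * N a c * (x c * y b))).
    rewrite -sumrB -big_split; apply: eq_bigr => a _.
    rewrite -sumrB -big_split; apply: eq_bigr => b _ /=.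
    have -> : \sum_c g a b * N b c * (x a * y c) =
      g a b * x a * \sum_c N b c * y c.
      by rewrite mulr_sumr; apply: eq_bigr => c _; ring.
    have -> : \sum_c g a b * N a c * (x c * y b) =
      g a b * y b * \sum_c N a c * x c.
      by rewrite mulr_sumr; apply: eq_bigr => c _; ring.
    ring.
  have -> : \sum_a \sum_b \sum_c g a b * N b c * (x a * y c) =
            \sum_a \sum_c \sum_b g a b * N b c * (x a * y c).
    by apply: eq_bigr => a _; rewrite exchange_big.
  (* A cyclic renaming of the indices and the symmetry of [g] bring out the same monomials
     [x a * y c] as in the other sum, so that the inner sum over [b] matches [gN]. *)
  have -> : \sum_a \sum_b \sum_c g a b * N a c * (x c * y b) =
            \sum_a \sum_c \sum_b g c b * N b a * (x a * y c).
    rewrite (eq_bigr (fun a => \sum_c \sum_b g a b * N a c * (x c * y b)));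
      last first.
      by move=> a _; rewrite exchange_big.
    rewrite exchange_big; apply: eq_bigr => a _; rewrite exchange_big.
    by apply: eq_bigr => c _; apply: eq_bigr => b _; rewrite (gC b c).
  rewrite -sumrB -big_split; apply: eq_bigr => a _.
  rewrite -sumrB -big_split; apply: eq_bigr => c _ /=.
  by rewrite -sumrB -gN mulr_suml; congr (_ + _); apply: eq_bigr => b _; ring.
have sw (f : 'I_n -> 'I_n -> R) : \sum_a \sum_b f a b =
  \sum_a \sum_b f b a by exact: exchange_big.
transitivity (\sum_a \sum_b (v b * g b a * x a + y b * P b a * x a)
            - \sum_a \sum_b (u b * g b a * y a + x b * P b a * y a)).
  rewrite [X in _ - X]sw -sumrB; apply: eq_bigr => a _; rewrite -sumrB;
    apply: eq_bigr => b _.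
  by rewrite (gC b a); ring.
rewrite -sumrB; apply: eq_bigr => a _.
by rewrite !big_split /= !mulrDl !mulr_suml [in X in _ - X]addrC
  [in X in X - _]addrC.
Qed.

(** * The Hilbert form in induced coordinates *)

Section InducedCoordinates.
Variables (R : realType) (A : atlas R).
Local Notation d := (Defs.dim A).
Implicit Types (E : 'rV[R]_(d + d) -> R) (z X Y : 'rV[R]_(d + d)).

Lemma dxE (a : 'I_d) : dx a = delta_mx 0 (lshift d a).
Proof.
apply/rowP => c; rewrite !mxE; case: splitP => [b|b] eb; rewrite !mxE /=.
  by rewrite -val_eqE /= -eb.
by rewrite -val_eqE /= eb gtn_eqF // (leq_trans (ltn_ord a)) ?leq_addr.
Qed.

Lemma dyE (a : 'I_d) : dy a = delta_mx 0 (rshift d a).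
Proof.
apply/rowP => c; rewrite !mxE; case: splitP => [b|b] eb; rewrite !mxE /=.
  by rewrite -val_eqE /= eb ltn_eqF // (leq_trans (ltn_ord b)) ?leq_addr.
by rewrite -[c == _]val_eqE /= eb eqn_add2l.
Qed.

Lemma derive_dx_dy E z X : differentiable E z ->
  'D_X E z = \sum_a lsubmx X 0 a * 'D_(dx a) E z +
    \sum_a rsubmx X 0 a * 'D_(dy a) E z.
Proof.
move=> dE; rewrite (derive_basis X dE) big_split_ord.
by apply: (f_equal2 +%R); apply: eq_bigr => a _;
  [rewrite dxE mxE|rewrite dyE mxE].
Qed.

(** [theta E] and [omega E] are the coefficients of the Hilbert form
    [1/2 dE/dy^a dx^a] and the negative of its exterior derivative. *)
Definition theta E (a : 'I_d) z : R := 2^-1 * 'D_(dy a) E z.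

Definition omega E z X Y : R :=
  \sum_a ('D_Y (theta E a) z * lsubmx X 0 a
          - 'D_X (theta E a) z * lsubmx Y 0 a).

Lemma Ck_dx k (U : set 'rV[R]_(d + d)) E a :
  Ck_on k.+1 U E -> Ck_on k U ('D_(dx a) E).
Proof. by rewrite dxE => -[_]; apply. Qed.

Lemma Ck_dy k (U : set 'rV[R]_(d + d)) E a :
  Ck_on k.+1 U E -> Ck_on k U ('D_(dy a) E).
Proof. by rewrite dyE => -[_]; apply. Qed.

Lemma Ck_theta k (U : set 'rV[R]_(d + d)) E a :
  open U -> Ck_on k.+1 U E -> Ck_on k U (theta E a).
Proof.
move=> oU CE; apply: Ck_on_M => //; first exact: Ck_on_cst.
exact: Ck_dy.
Qed.

Lemma omega_antisym E z X Y : omega E z X Y = - omega E z Y X.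
Proof. by rewrite /omega -sumrN; apply: eq_bigr => a _; rewrite opprB. Qed.

Lemma omega_linear E z (t : R) X X' Y :
  (forall a, differentiable (theta E a) z) ->
  omega E z (t *: X + X') Y = t * omega E z X Y + omega E z X' Y.
Proof.
move=> dth.
have D a : 'D_(t *: X + X') (theta E a) z = t * 'D_X (theta E a) z +
  'D_X' (theta E a) z.
  by rewrite !(deriveE _ (dth a)) linearP.
have L a : lsubmx (t *: X + X') 0 a = t * lsubmx X 0 a +
  lsubmx X' 0 a by rewrite !mxE.
rewrite /omega mulr_sumr -big_split; apply: eq_bigr => a _ /=.
rewrite (D a) (L a); move: ('D_Y _ _) ('D_X _ _) ('D_X' _ _) => k1 k2 k3; ring.
Qed.

Variables (F : tangent A -> R) (i : Defs.index A) (U : set 'rV[R]_(d + d)).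
Local Notation E := (sqF F i).
Local Notation g := (fundamental F i).
Local Notation N := (connection F i).
Hypotheses (oU : open U) (CE : Ck_on 3 U E)
  (Ug : forall z, U z -> g z \in unitmx).

Let Exy f x a b (Ux : U x) (C : Ck_on 2 U f) :=
  @Ck_on_derive_comm _ _ U f x a b oU Ux C.

Lemma fundamental_sym z a b : U z -> g z a b = g z b a.
Proof.
move=> Uz; rewrite mxE [RHS]mxE !dyE.
exact: (f_equal ( *%R 2^-1) (Exy _ _ Uz (Ck_onW CE))).
Qed.

(** The spray with its index lowered by [g]. No inverse matrix occurs in it, so its fibre
    derivatives are explicit. *)
Definition lowered_spray (a : 'I_d) z : R :=
  4^-1 * ((\sum_c 'D_(dy a) ('D_(dx c) E) z * rsubmx z 0 c) - 'D_(dx a) E z).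

Lemma sprayE b z : spray F i b z = \sum_a invmx (g z) b a * lowered_spray a z.
Proof.
by rewrite /spray mulr_sumr; apply: eq_bigr => c _; rewrite mulrCA.
Qed.

Lemma lowered_sprayE z a : U z ->
  \sum_b g z a b * spray F i b z = lowered_spray a z.
Proof.
move=> Uz.
have E1 : g z *m (invmx (g z) *m \col_b lowered_spray b z) =
  \col_b lowered_spray b z.
  by rewrite mulmxA mulmxV ?mul1mx ?Ug.
have := congr1 (fun M : 'cV[R]_d => M a 0) E1; rewrite !mxE => <-.
apply: eq_bigr => b _; congr (_ * _); rewrite sprayE !mxE.
by apply: eq_bigr => c _; rewrite !mxE.
Qed.

Lemma differentiable_fundamental z a b : U z ->
  differentiable (fun z => g z a b) z.
Proof.
move=> Uz; under eq_fun do rewrite mxE.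
apply: differentiableM; first exact: differentiable_cst.
exact: ((Ck_dy a (Ck_dy b CE)).1 _ Uz).
Qed.

Lemma differentiable_rsubmx_coord z (c : 'I_d) :
  differentiable (fun z : 'rV[R]_(d + d) => rsubmx z 0 c) z.
Proof. by under eq_fun do rewrite mxE; exact: differentiable_coord. Qed.

Lemma derive_rsubmx_coord z X (c : 'I_d) :
  'D_X (fun z : 'rV[R]_(d + d) => rsubmx z 0 c) z = rsubmx X 0 c.
Proof.
have -> : (fun z : 'rV[R]_(d + d) => rsubmx z 0 c) = fun z => z 0 (rshift d c).
  by apply/funext => y; rewrite mxE.
by rewrite (@derive_coord _ _ _ id); [rewrite derive_id mxE|exact: ex_diff].
Qed.

Lemma rsubmx_dy (a b : 'I_d) : rsubmx (dy a) 0 b = (b == a)%:R.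
Proof. by rewrite /dy row_mxKr mxE eqxx. Qed.

Lemma differentiable_lowered_spray z a : U z ->
  differentiable (lowered_spray a) z.
Proof.
move=> Uz; apply: differentiableM; first exact: differentiable_cst.
apply: differentiableB; last exact: ((Ck_dx a (Ck_onW CE)).1 _ Uz).
apply: differentiable_bigsum => c; apply: differentiableM.
  exact: ((Ck_dy a (Ck_dx c CE)).1 _ Uz).
exact: differentiable_rsubmx_coord.
Qed.

(** Serves the Leibniz rule for [g_ab G^b]: only the existence of the derivative matters there, so
    the derivative of the inverse matrix is not computed. *)
Lemma differentiable_spray z b : U z -> differentiable (spray F i b) z.
Proof.
move=> Uz.
have -> : spray F i b = fun z => \sum_a invmx (g z) b a * lowered_spray a z.
  by apply/funext => y; exact: sprayE.
apply: differentiable_bigsum => a; apply: differentiableM.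
  apply: differentiable_invmx; last exact: open_near oU Uz Ug.
  by move=> c e; exact: differentiable_fundamental.
exact: differentiable_lowered_spray.
Qed.

(** Differentiating the factor [rsubmx z 0 e] picks out the term ['D_(dy a) ('D_(dx c) E) z]. The
    remaining third-order sum is the part symmetric in [a] and [c]. *)
Lemma derive_lowered_spray z a c : U z ->
  'D_(dy c) (lowered_spray a) z =
  4^-1 * ('D_(dy a) ('D_(dx c) E) z - 'D_(dy c) ('D_(dx a) E) z
    + \sum_e rsubmx z 0 e * 'D_(dy c) ('D_(dy a) ('D_(dx e) E)) z).
Proof.
move=> Uz.
have d1 e : differentiable ('D_(dy a) ('D_(dx e) E)) z.
  exact: ((Ck_dy a (Ck_dx e CE)).1 _ Uz).
have d2 : differentiable ('D_(dx a) E) z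
  by exact: ((Ck_dx a (Ck_onW CE)).1 _ Uz).
have d3 e := differentiable_rsubmx_coord z e.
have d4 : differentiable
  (fun z => \sum_e 'D_(dy a) ('D_(dx e) E) z * rsubmx z 0 e) z.
  by apply: differentiable_bigsum => e; exact: differentiableM (d1 e) (d3 e).
have -> : lowered_spray a =
  4^-1 \*: ((fun z => \sum_e 'D_(dy a) ('D_(dx e) E) z * rsubmx z 0 e) -
    'D_(dx a) E) by [].
rewrite deriveZ; last exact: diff_derivable (differentiableB d4 d2).
apply: (f_equal ( *%R 4^-1));
  rewrite (deriveB (diff_derivable d4) (diff_derivable d2)).
rewrite (derive_sumM _ d1 d3) big_split /= addrAC; apply: (f_equal2 +%R) => //.
apply: (f_equal2 +%R) => //.
have d5 e : 'D_(dy c) (fun z : 'rV[R]_(d + d) => rsubmx z 0 e) z = (e == c)%:R.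
  by rewrite derive_rsubmx_coord rsubmx_dy.
rewrite (bigD1 c) //= [X in _ + X]big1 ?addr0 => [|e ec].
  by rewrite d5 eqxx mulr1.
by rewrite d5 (negPf ec) mulr0.
Qed.

(** Differentiating [g_ab G^b = lowered_spray a] along [dy c] gives [g_ab N^b_c]
    up to terms symmetric in [a] and [c], which cancel; homogeneity of [F] is
    not involved. *)
Lemma connection_antisym z a c : U z ->
  \sum_b (g z a b * N z b c - g z c b * N z b a) =
  2^-1 * 'D_(dy a) ('D_(dx c) E) z - 2^-1 * 'D_(dy c) ('D_(dx a) E) z.
Proof.
move=> Uz.
pose S a c := \sum_b spray F i b z * 'D_(dy c) (fun z => g z a b) z.
have gN a' c' : \sum_b g z a' b * N z b c' = 'D_(dy c') (lowered_spray a') z -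
  S a' c'.
  have <- : 'D_(dy c') (fun z => \sum_b g z a' b * spray F i b z) z =
    'D_(dy c') (lowered_spray a') z.
    by apply: near_eq_derive; apply: (open_near oU Uz) => y Uy;
      exact: lowered_sprayE.
  rewrite derive_sumM ?big_split ?addrK // => b.
    exact: differentiable_fundamental.
  exact: differentiable_spray.
have gC a' c' b : 'D_(dy c') (fun z => g z a' b) z =
  2^-1 * 'D_(dy c') ('D_(dy a') ('D_(dy b) E)) z.
  have -> : (fun z => g z a' b) = 2^-1 \*: ('D_(dy a') ('D_(dy b) E)).
    by apply/funext => y; rewrite mxE.
  by rewrite deriveZ //; exact: diff_derivable ((Ck_dy a' (Ck_dy b CE)).1 _ Uz).
have DC E' a' c' : Ck_on 2 U E' -> 'D_(dy c') ('D_(dy a') E') z =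
  'D_(dy a') ('D_(dy c') E') z.
  by move=> C2; rewrite !dyE; exact: (Exy _ _ Uz C2).
have SC : S a c = S c a.
  apply: eq_bigr => b _; apply: (f_equal ( *%R (spray F i b z))).
  rewrite (gC a c b) (gC c a b).
  have eqM (k u v : R) : u = v -> k * u = k * v by move=> ->.
  exact: eqM (DC ('D_(dy b) E) a c (Ck_dy b CE)).
have TC : \sum_e rsubmx z 0 e * 'D_(dy c) ('D_(dy a) ('D_(dx e) E)) z =
          \sum_e rsubmx z 0 e * 'D_(dy a) ('D_(dy c) ('D_(dx e) E)) z.
  apply: eq_bigr => e _.
  exact: (f_equal ( *%R (rsubmx z 0 e)) (DC ('D_(dx e) E) a c (Ck_dx e CE))).
(* The difference [p - q] is already antisymmetric under the exchange of [a] and [c], so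
   antisymmetrizing doubles it and turns [4^-1] into [2^-1]. *)
have alg (u1 u2 h1 h2 s1 s2 t1 t2 p q : R) : u1 = h1 - s1 -> u2 = h2 - s2 ->
    h1 = 4^-1 * (p - q + t1) -> h2 = 4^-1 * (q - p + t2) ->
    s1 = s2 -> t1 = t2 -> u1 - u2 = 2^-1 * p - 2^-1 * q.
  by move=> -> -> -> -> -> ->; field.
rewrite sumrB.
exact: alg (gN a c) (gN c a) (derive_lowered_spray a c Uz)
  (derive_lowered_spray c a Uz) SC TC.
Qed.

(** The base derivatives of [theta] are the mixed derivatives [P] produced by [connection_antisym],
    and its fibre derivatives are the entries of [g]; these are exactly the coefficients on the
    right of [lowered_form_expand]. *)
Lemma fundamental_form_omega z X Y : U z ->
  \sum_a \sum_b g z a b *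
    (lsubmx X 0 a * delta_y F i z b Y - delta_y F i z a X * lsubmx Y 0 b)
  = omega E z X Y.
Proof.
move=> Uz.
pose P c a := 2^-1 * 'D_(dx c) ('D_(dy a) E) z.
have PE c a : P c a = 2^-1 * 'D_(dy a) ('D_(dx c) E) z.
  rewrite /P dxE dyE; exact: (f_equal ( *%R 2^-1) (Exy _ _ Uz (Ck_onW CE))).
rewrite (@lowered_form_expand _ _ (g z) (N z) P); last 2 first.
- by move=> a b; exact: fundamental_sym.
- move=> a c; apply: etrans (connection_antisym a c Uz) _.
  exact: (f_equal2 (fun s t => s - t) (esym (PE c a)) (esym (PE a c))).
have dth a X' : 'D_X' (theta E a) z = \sum_c lsubmx X' 0 c * P c a +
  \sum_b rsubmx X' 0 b * g z b a.
  have dE := (Ck_dy a (Ck_onW CE)).1 _ Uz.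
  have -> : theta E a = 2^-1 \*: 'D_(dy a) E by [].
  rewrite deriveZ; last exact: diff_derivable dE.
  apply: etrans (f_equal ( *%R 2^-1) (derive_dx_dy X' dE)) _.
  apply: etrans (mulrDr _ _ _) _; apply: (f_equal2 +%R).
    by apply: etrans (mulr_sumr _ _ _ _) _; apply: eq_bigr => b _;
      exact: mulrCA.
  apply: etrans (mulr_sumr _ _ _ _) _; apply: eq_bigr => b _.
  by rewrite [g z b a]mxE; exact: mulrCA.
apply: eq_bigr => a _; rewrite (dth a X) (dth a Y); reflexivity.
Qed.

End InducedCoordinates.

(** * Invariance under bundle maps *)

Section Composition.
Variable R : realType.

Lemma derive_comp (U V W : normedModType R) (f : U -> V) (h : V -> W)
    (x u : U) :
  differentiable f x -> differentiable h (f x) ->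
  'D_u (h \o f) x = 'D_('d f x u) h (f x).
Proof.
move=> df dh; rewrite (deriveE _ (differentiable_comp df dh)) (deriveE _ dh).
by rewrite (diff_comp df dh).
Qed.

Lemma derive_comp_lsubmx (W : normedModType R) m n (h : 'rV[R]_m -> W)
    (z u : 'rV[R]_(m + n)) :
  differentiable h (lsubmx z) ->
  'D_u (h \o lsubmx) z = 'D_(lsubmx u) h (lsubmx z).
Proof.
move=> dh; rewrite (derive_comp _ (differentiable_lsubmx z) dh).
by rewrite (diff_lin _ (@continuous_lsubmx _ _ _ _)).
Qed.

Lemma differentiable_rV (V : normedModType R) n (f : V -> 'rV[R]_n) (x : V) :
  (forall b, differentiable (fun y => f y 0 b) x) -> differentiable f x.
Proof.
move=> df.
have -> : f = fun y => \sum_b f y 0 b *: delta_mx 0 b.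
  by apply/funext => y; exact: row_sum_delta.
by apply: differentiable_bigsum => b; exact: differentiableZl (df b).
Qed.

End Composition.

(** Here [f] is the Jacobian of the base map, [h] its second derivatives, [t] the Hilbert
    coefficients at the image point, and [P], [Q] their derivatives along the images of [X] and [Y].
    The second derivatives meet the factor [y c * x a - x c * y a], antisymmetric in [a] and [c],
    and drop out. *)
Lemma pullback_form_expand (R : comPzRingType) n (h : 'I_n -> 'I_n -> 'I_n -> R)
    (f : 'I_n -> 'I_n -> R) (t P Q x y : 'I_n -> R) :
  (forall c a b, h c a b = h a c b) ->
  \sum_a ((\sum_b (t b * (\sum_c y c * h c a b) + f a b * Q b)) * x a
        - (\sum_b (t b * (\sum_c x c * h c a b) + f a b * P b)) * y a) =
  \sum_b (Q b * (\sum_a x a * f a b) - P b * (\sum_a y a * f a b)).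
Proof.
move=> hC.
transitivity (\sum_a \sum_b (t b * (\sum_c (y c * x a - x c * y a) * h c a b)
    + (Q b * (x a * f a b) - P b * (y a * f a b)))).
  apply: eq_bigr => a _; rewrite !mulr_suml -sumrB; apply: eq_bigr => b _.
  have -> : \sum_c (y c * x a - x c * y a) * h c a b =
      (\sum_c y c * h c a b) * x a - (\sum_c x c * h c a b) * y a.
    by rewrite !mulr_suml -sumrB; apply: eq_bigr => c _; ring.
  ring.
rewrite exchange_big; apply: eq_bigr => b _;
  rewrite big_split /= sumrB -!mulr_sumr.
suff -> : \sum_a \sum_c (y c * x a - x c * y a) * h c a b =
  0 by rewrite mulr0 add0r.
under eq_bigr do [under eq_bigr do rewrite mulrBl; rewrite sumrB].
rewrite sumrB [X in _ - X]exchange_big /=; apply/eqP; rewrite subr_eq0;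
  apply/eqP.
by apply: eq_bigr => a _; apply: eq_bigr => c _; rewrite (hC c) [y c * _]mulrC.
Qed.

Section Pullback.
Variables (R : realType) (A : atlas R).
Local Notation d := (Defs.dim A).
Variables (phi : 'rV[R]_d -> 'rV[R]_d) (T : 'rV[R]_(d + d) -> 'rV[R]_(d + d)).
Variable (W : set 'rV[R]_d).
Hypotheses (oW : open W) (Cphi : Ck_on 2 W phi).
Hypothesis TE : forall z, W (lsubmx z) ->
  T z = row_mx (phi (lsubmx z)) ('d phi (lsubmx z) (rsubmx z)).

Let dphi (a b : 'I_d) : 'rV[R]_d -> R := 'D_(delta_mx 0 a) (fun x => phi x 0 b).

Let Cphib b : Ck_on 2 W (fun x => phi x 0 b).
Proof. exact: Ck_on_coord. Qed.

Let diff_phib x b : W x -> differentiable (fun x => phi x 0 b) x.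
Proof. exact: (Cphib b).1. Qed.

Let diff_dphi x a b : W x -> differentiable (dphi a b) x.
Proof. exact: ((Cphib b).2 a).1. Qed.

Let dphi_diff x v b : W x -> 'd phi x v 0 b = \sum_a v 0 a * dphi a b x.
Proof.
move=> Wx; rewrite -deriveE; last exact: Cphi.1.
by rewrite -derive_coord; [exact: derive_basis (diff_phib b Wx)|exact: Cphi.1].
Qed.

Let oLW : open (lsubmx @^-1` W : set 'rV[R]_(d + d)).
Proof. by apply: open_comp oW => z _; exact: continuous_lsubmx. Qed.

(** [T] is prescribed only over [W]. Its coordinates are studied through [Tl] and [Tr], which agree
    with them near every point over [W]. *)
Let Tl (b : 'I_d) (z : 'rV[R]_(d + d)) : R := phi (lsubmx z) 0 b.
Let Tr (b : 'I_d) (z : 'rV[R]_(d + d)) : R :=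
  \sum_a rsubmx z 0 a * dphi a b (lsubmx z).

Let TlE z b : W (lsubmx z) -> \near z, Tl b z = T z 0 (lshift d b).
Proof.
move=> Wz; apply: (open_near oLW Wz) => y Wy.
by rewrite TE // row_mxEl.
Qed.

Let TrE z b : W (lsubmx z) -> \near z, Tr b z = T z 0 (rshift d b).
Proof.
move=> Wz; apply: (open_near oLW Wz) => y Wy.
by rewrite TE // row_mxEr dphi_diff.
Qed.

Let diff_lsubmx_comp (f : 'rV[R]_d -> R) (z : 'rV[R]_(d + d)) :
  differentiable f (lsubmx z) ->
  differentiable (fun z : 'rV[R]_(d + d) => f (lsubmx z)) z.
Proof.
by move=> df; exact: (differentiable_comp (differentiable_lsubmx z) df).
Qed.

Let diff_Tl z b : W (lsubmx z) -> differentiable (Tl b) z.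
Proof. by move=> Wz; exact: diff_lsubmx_comp (diff_phib b Wz). Qed.

Let diff_Tr z b : W (lsubmx z) -> differentiable (Tr b) z.
Proof.
move=> Wz; apply: differentiable_bigsum => a; apply: differentiableM.
  exact: differentiable_rsubmx_coord.
exact: diff_lsubmx_comp (diff_dphi a b Wz).
Qed.

Lemma differentiable_bundle_map z : W (lsubmx z) -> differentiable T z.
Proof.
move=> Wz; apply: differentiable_rV => b; rewrite -[b]fintype.splitK.
case: (fintype.split b) => c /=.
  exact: near_eq_differentiable (TlE c Wz) (diff_Tl c Wz).
exact: near_eq_differentiable (TrE c Wz) (diff_Tr c Wz).
Qed.

Lemma lsubmx_diff_bundle_map z X b : W (lsubmx z) ->
  lsubmx ('d T z X) 0 b = \sum_a lsubmx X 0 a * dphi a b (lsubmx z).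
Proof.
move=> Wz; have dT := differentiable_bundle_map Wz.
rewrite mxE -(deriveE _ dT) -(derive_coord _ _ dT).
rewrite -(near_eq_derive _ (TlE b Wz)).
rewrite (@derive_comp_lsubmx _ _ _ _ (fun x => phi x 0 b));
  last exact: diff_phib.
exact: derive_basis (diff_phib b Wz).
Qed.

(** [T] covers [phi] and is linear on fibres, so its differential maps vertical vectors to vertical
    vectors through the Jacobian of [phi]. The naturality of [theta] rests on this. *)
Lemma diff_bundle_map_dy z a : W (lsubmx z) ->
  'd T z (dy a) = \sum_b dphi a b (lsubmx z) *: dy b.
Proof.
move=> Wz; have dT := differentiable_bundle_map Wz.
have ldy : lsubmx (dy a) = 0 by rewrite /dy row_mxKl.
apply/rowP => c; rewrite -[c]fintype.splitK summxE;
  case: (fintype.split c) => b /=.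
  have := lsubmx_diff_bundle_map (dy a) b Wz; rewrite mxE => ->.
  rewrite ldy big1 => [|e _]; last by rewrite mxE mul0r.
  by rewrite big1 // => e _; rewrite mxE /dy row_mxEl mxE mulr0.
rewrite -(deriveE _ dT) -(derive_coord _ _ dT) -(near_eq_derive _ (TrE b Wz)).
rewrite derive_sumM; last 2 first.
- by move=> e; exact: differentiable_rsubmx_coord.
- by move=> e; exact: diff_lsubmx_comp (diff_dphi e b Wz).
rewrite big_split /= [X in X + _]big1 ?add0r.
  rewrite (bigD1 a) //= derive_rsubmx_coord rsubmx_dy eqxx mulr1 big1 ?addr0.
    rewrite (bigD1 b) //= big1 ?addr0.
      by rewrite mxE /dy row_mxEr mxE !eqxx mulr1.
    by move=> e eb; rewrite mxE /dy row_mxEr mxE eqxx eq_sym (negPf eb) mulr0.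
  by move=> e ea; rewrite derive_rsubmx_coord rsubmx_dy (negPf ea) mulr0.
move=> e _; rewrite (@derive_comp_lsubmx _ _ _ _ (dphi e b));
  last exact: diff_dphi.
by rewrite ldy derive0 mulr0.
Qed.

(** The second derivatives of [phi] enter symmetrically and cancel, as in
    [d (T^* theta) = T^* (d theta)]. *)
Lemma omega_pullback (U1 U2 : set 'rV[R]_(d + d)) (E1 E2 : 'rV[R]_(d + d) -> R)
    z X Y :
  open U1 -> U1 `<=` lsubmx @^-1` W -> U1 `<=` T @^-1` U2 ->
  {in U1, forall y, E1 y = E2 (T y)} ->
  Ck_on 2 U2 E2 -> U1 z ->
  omega E1 z X Y = omega E2 (T z) ('d T z X) ('d T z Y).
Proof.
move=> oU1 U1W U1U2 E12 C2 Uz; have Wz := U1W _ Uz; have U2z := U1U2 _ Uz.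
have dE2 y : U1 y -> differentiable E2 (T y) by move=> /U1U2; exact: C2.1.
have dth b : differentiable (theta E2 b) (T z).
  apply: differentiableM; first exact: differentiable_cst.
  exact: ((Ck_dy b C2).1 _ U2z).
have dT := differentiable_bundle_map Wz.
(* Naturality of the Hilbert form is needed on all of [U1] and not just at [z], because it is
   differentiated next. *)
have th1 a y : U1 y -> theta E1 a y = \sum_b theta E2 b (T y) * dphi a b
  (lsubmx y).
  move=> Uy; have Wy := U1W _ Uy.
  have -> : theta E1 a y = 2^-1 * 'D_(dy a) (E2 \o T) y.
    apply: (f_equal ( *%R 2^-1)); apply: near_eq_derive.
    by apply: (open_near oU1 Uy) => y' Uy'; apply: E12; rewrite inE.
  rewrite (derive_comp _ (differentiable_bundle_map Wy) (dE2 _ Uy)).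
  rewrite (deriveE _ (dE2 _ Uy)) diff_bundle_map_dy // linear_sum mulr_sumr.
  apply: eq_bigr => b _; rewrite linearZ -(deriveE _ (dE2 _ Uy)).
  by rewrite /theta mulrAC mulrA.
have Dth a X' : 'D_X' (theta E1 a) z =
    \sum_b (theta E2 b (T z) *
      (\sum_c lsubmx X' 0 c * 'D_(delta_mx 0 c) (dphi a b) (lsubmx z))
           + dphi a b (lsubmx z) * 'D_('d T z X') (theta E2 b) (T z)).
  rewrite (near_eq_derive _ (open_near oU1 Uz (th1 a))).
  rewrite derive_sumM; last 2 first.
  - by move=> b; exact: differentiable_comp dT (dth b).
  - by move=> b; exact: diff_lsubmx_comp (diff_dphi a b Wz).
  apply: eq_bigr => b _; apply: (f_equal2 +%R).
    apply: (f_equal ( *%R (theta E2 b (T z)))).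
    apply: etrans (derive_comp_lsubmx _ (diff_dphi a b Wz)) _.
    exact: derive_basis (diff_dphi a b Wz).
  exact: (f_equal ( *%R (dphi a b (lsubmx z))) (derive_comp _ dT (dth b))).
apply: etrans (eq_bigr _ (fun a _ =>
  f_equal2 (fun s t => s * lsubmx X 0 a - t * lsubmx Y 0 a) (Dth a Y)
    (Dth a X))) _.
rewrite pullback_form_expand; last first.
  by move=> c a b; exact: Ck_on_derive_comm oW Wz (Cphib b).
by apply: eq_bigr => b _; rewrite !lsubmx_diff_bundle_map.
Qed.

End Pullback.

(** * The tangent atlas *)

Section TangentAtlas.
Variables (R : realType) (A : atlas R).
Local Notation d := (Defs.dim A).
Local Notation TA := (tangent A).
Hypothesis Acover : forall p : A, dom (pref p) p.
Hypothesis AparamK : forall (i : Defs.index A) (p : A), dom i p ->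
  param i (Defs.coord i p) = p.
Hypothesis Aoverlap : forall i j : Defs.index A, open (chart_image i (dom j)).
Hypothesis Atransition : forall i j : Defs.index A,
  smooth_on (chart_image i (dom j)) (transition i j).
Implicit Types (i j k : Defs.index A) (p : A) (x u v : 'rV[R]_d).

Lemma chart_imageP i (S : set A) x :
  chart_image i S x <->
    [/\ dom i (param i x), S (param i x) & Defs.coord i (param i x) = x].
Proof.
split=> [[p [ip Sp] <-]|[ix Sx xE]]; first by rewrite AparamK.
by exists (param i x).
Qed.

Lemma param_transition i j x :
  chart_image i (dom j) x -> param j (transition i j x) = param i x.
Proof. by move=> /chart_imageP[ix jx _]; rewrite /transition /= AparamK. Qed.

Lemma differentiable_transition i j x :
  chart_image i (dom j) x -> differentiable (transition i j) x.
Proof. by move=> ijx; have [+ _] := Atransition i j 1; apply. Qed.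

(** The cocycle rule: the composite agrees with the direct transition on the open set
    [chart_image i (dom j)], so the chain rule computes the same differential. *)
Lemma diff_transition_comp i j k x u :
  chart_image i (dom j) x -> chart_image i (dom k) x ->
  'd (transition j k) (transition i j x) ('d (transition i j) x u) =
    'd (transition i k) x u.
Proof.
move=> ijx ikx; have dij := differentiable_transition ijx.
have djk : differentiable (transition j k) (transition i j x).
  apply: differentiable_transition;
    move: ijx ikx => /chart_imageP[ix jx _] /chart_imageP[_ kx _].
  by exists (param i x).
apply: etrans (esym (f_equal (fun f => f u) (diff_comp dij djk))) _; cbv beta.
have E y : chart_image i (dom j) y -> (transition j k \o transition i j) y =
  transition i k y.
  by move=> ijy; rewrite /= {1}/transition /= param_transition.
exact: near_eq_diff u (open_near (@Aoverlap i j) ijx E)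
  (differentiable_comp dij djk).
Qed.

Lemma diff_transition_id i x u :
  chart_image i (dom i) x -> 'd (transition i i) x u = u.
Proof.
move=> iix; have di := differentiable_transition iix.
have E y : chart_image i (dom i) y -> transition i i y = id y.
  by case/chart_imageP.
by rewrite (near_eq_diff _ (open_near (@Aoverlap i i) iix E) di) diff_val.
Qed.

Lemma chart_image_pref i p : dom i p ->
  chart_image i (dom (pref p)) (Defs.coord i p).
Proof. by move=> ip; exists p => //; split=> //; exact: Acover. Qed.

Lemma pref_chart_image i p : dom i p ->
  chart_image (pref p) (dom i) (Defs.coord (pref p) p).
Proof. by move=> ip; exists p => //; split=> //; exact: Acover. Qed.

Lemma tangent_compK i p v : dom i p ->
  tangent_vec i (Defs.coord i p) (tangent_comp i p v) = v.
Proof.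
move=> ip; have pip := pref_chart_image ip.
have ppp := pref_chart_image (Acover p).
rewrite /tangent_vec /tangent_comp AparamK //.
have := diff_transition_comp v pip ppp.
have -> : transition (pref p) i (Defs.coord (pref p) p) = Defs.coord i p.
  by rewrite /transition /= AparamK.
by move=> ->; rewrite diff_transition_id.
Qed.

(** The preferred chart is only the middle term of the cocycle rule and leaves no trace. The
    transitions of the tangent atlas are thus the bundle maps treated above. *)
Lemma tangent_vecK i j x u : chart_image i (dom j) x ->
  tangent_comp j (param i x) (tangent_vec i x u) = 'd (transition i j) x u.
Proof.
move=> ijx; have /chart_imageP[ix jx xE] := ijx.
have ipx : chart_image i (dom (pref (param i x))) x.
  by rewrite -{2}xE; exact: chart_image_pref.
exact: diff_transition_comp u ipx ijx.
Qed.

Lemma tangent_paramK i (q : TA) : dom i q.1 ->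
  @param R TA i (@Defs.coord R TA i q) = q.
Proof.
move=> iq; rewrite /= row_mxKl row_mxKr AparamK // tangent_compK //.
by case: q iq.
Qed.

Lemma tangent_transitionE i j (z : 'rV[R]_(d + d)) :
  chart_image i (dom j) (lsubmx z) ->
  @transition R TA i j z =
  row_mx (transition i j (lsubmx z))
    ('d (transition i j) (lsubmx z) (rsubmx z)).
Proof.
by move=> ijz; rewrite {1}/transition /= tangent_vecK.
Qed.

(** Allows the slit condition, which is stated for components in the preferred chart, to be tested
    in any chart. *)
Lemma tangent_vec_eq0 i x u : chart_image i (dom i) x ->
  (tangent_vec i x u == 0) = (u == 0).
Proof.
move=> iix; apply/eqP/eqP => [v0|->]; last by rewrite /tangent_vec linear0.
by rewrite -(diff_transition_id u iix) -(tangent_vecK u iix) v0 /tangent_comp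
  linear0.
Qed.

Lemma tangent_coordK i (z : 'rV[R]_(d + d)) :
  chart_image i (dom i) (lsubmx z) ->
  @Defs.coord R TA i (@param R TA i z) = z.
Proof.
move=> iiz; have /chart_imageP[_ _ zE] := iiz.
by rewrite /= zE tangent_vecK // diff_transition_id // hsubmxK.
Qed.

Lemma tangent_chart_imageP i (S : set TA) (z : 'rV[R]_(d + d)) :
  @chart_image R TA i S z <->
  chart_image i (dom i) (lsubmx z) /\ S (@param R TA i z).
Proof.
split=> [[q [iq Sq] <-]|[iiz Sz]].
  by rewrite tangent_paramK //= row_mxKl; split=> //; exists q.1.
have /chart_imageP[iz _ _] := iiz.
by exists (@param R TA i z) => //; rewrite tangent_coordK.
Qed.

(** * The almost complex structure in the adapted coframe *)

Section AlmostComplex.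
Variable F : TA -> R.
Implicit Types (z X Y : 'rV[R]_(d + d)).

Lemma row_scaleE (c : R) v (a : 'I_d) : (c *: v) 0 a = c * v 0 a.
Proof. exact: mxE. Qed.

Lemma row_oppE v (a : 'I_d) : (- v) 0 a = - v 0 a.
Proof. exact: mxE. Qed.

Lemma lsubmx_dx (a b : 'I_d) : lsubmx (dx a) 0 b = (b == a)%:R.
Proof. by rewrite /dx row_mxKl mxE eqxx. Qed.

Lemma lsubmx_dy (a b : 'I_d) : lsubmx (dy a) 0 b = 0.
Proof. by rewrite /dy row_mxKl mxE. Qed.

Lemma rsubmx_dx (a b : 'I_d) : rsubmx (dx a) 0 b = 0.
Proof. by rewrite /dx row_mxKr mxE. Qed.

Lemma lsubmx_delta_x i z (a b : 'I_d) :
  lsubmx (delta_x F i z a) 0 b = (b == a)%:R.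
Proof.
rewrite /delta_x linearB /= linear_sum /= mxE lsubmx_dx mxE summxE big1 ?subr0
  // => c _.
by rewrite linearZ mxE lsubmx_dy mulr0.
Qed.

Lemma rsubmx_delta_x i z (a b : 'I_d) :
  rsubmx (delta_x F i z a) 0 b = - connection F i z b a.
Proof.
rewrite /delta_x linearB /= linear_sum /= mxE rsubmx_dx mxE summxE add0r.
rewrite (bigD1 b) //= big1 => [|c cb]; rewrite linearZ mxE rsubmx_dy.
  by rewrite eqxx mulr1 addr0.
by rewrite eq_sym (negPf cb) mulr0.
Qed.

(** In the coframe [(dx^a, delta_y a)] the map [J] acts by [(xi, eta) |-> (eta, - xi)]; this is its
    first half, and [delta_y_complex_structure] is the second. *)
Lemma lsubmx_complex_structure q Y (a : 'I_d) :
  lsubmx (complex_structure F q Y) 0 a =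
  delta_y F (pref q.1) (@Defs.coord R TA (pref q.1) q) a Y.
Proof.
rewrite /complex_structure; set i := Defs.pref _; set z := Defs.coord i q.
rewrite linearD /= !linear_sum /= mxE !summxE big1 ?add0r => [|c _].
  rewrite (bigD1 a) //= big1 => [|c ca]; rewrite linearZ mxE lsubmx_delta_x.
    by rewrite eqxx mulr1 addr0.
  by rewrite eq_sym (negPf ca) mulr0.
by rewrite linearZ linearN /= row_scaleE row_oppE lsubmx_dy oppr0 mulr0.
Qed.

Lemma delta_y_complex_structure q Y (a : 'I_d) :
  delta_y F (pref q.1) (@Defs.coord R TA (pref q.1) q) a
    (complex_structure F q Y) =
  - lsubmx Y 0 a.
Proof.
rewrite {1}/delta_y
  (eq_bigr _ (fun b _ => f_equal _ (lsubmx_complex_structure q Y b))).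
rewrite /complex_structure; set i := Defs.pref _; set z := Defs.coord i q.
rewrite linearD /= !linear_sum /= mxE !summxE.
rewrite (bigD1 a) //= [X in _ + X + _ + _]big1 => [|c ca];
  rewrite linearZ linearN /= row_scaleE row_oppE rsubmx_dy.
  (* [delta_y] annihilates every [delta_x]: the fibre component [- N] cancels the connection
     term. *)
  rewrite eqxx mulrN1 addr0 -addrA -big_split big1 ?addr0 //= => c _.
  by rewrite linearZ mxE rsubmx_delta_x mulrN mulrC addNr.
by rewrite eq_sym (negPf ca) oppr0 mulr0.
Qed.

(** [J] exchanges the horizontal and the vertical sum of the metric, and its signs cancel in
    pairs. *)
Lemma sasaki_matsumoto_hermitian q X Y :
  sasaki_matsumoto F q (complex_structure F q X) (complex_structure F q Y) =
  sasaki_matsumoto F q X Y.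
Proof.
rewrite /sasaki_matsumoto addrC; apply: (f_equal2 +%R).
  apply: eq_bigr => a _; apply: eq_bigr => b _.
  by rewrite !delta_y_complex_structure mulrNN.
apply: eq_bigr => a _; apply: eq_bigr => b _.
by rewrite !lsubmx_complex_structure.
Qed.

Lemma fundamental_formE (q : TA) X Y :
  let i := pref q.1 in let z := @Defs.coord R TA i q in
  sasaki_matsumoto F q X (complex_structure F q Y) =
  \sum_a \sum_b fundamental F i z a b *
    (lsubmx X 0 a * delta_y F i z b Y - delta_y F i z a X * lsubmx Y 0 b).
Proof.
move=> i z; rewrite /sasaki_matsumoto -big_split; apply: eq_bigr => a _.
rewrite -big_split; apply: eq_bigr => b _ /=.
by rewrite lsubmx_complex_structure delta_y_complex_structure mulrN -mulrDr.
Qed.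

End AlmostComplex.

(** * Components of the exterior derivative of the Hilbert form *)

Section ExteriorDerivative.
Variables (U : set 'rV[R]_(d + d)) (E : 'rV[R]_(d + d) -> R).
Hypothesis oU : open U.

(** The component of the Hilbert form along the [a]-th of all [2 d] coordinates,
    which is [0] for the fibre coordinates. *)
Definition theta_comp (a : 'I_(d + d)) (z : 'rV[R]_(d + d)) : R :=
  \sum_c lsubmx (delta_mx 0 a : 'rV[R]_(d + d)) 0 c * theta E c z.

Lemma Ck_theta_comp (k : nat) a : Ck_on k.+1 U E -> Ck_on k U (theta_comp a).
Proof.
move=> CE; apply: Ck_on_sum => // c; apply: Ck_on_M => //;
  first exact: Ck_on_cst.
exact: Ck_theta.
Qed.

(** With all [2 d] coordinates on the same footing, [omega] becomes a plain difference of partial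
    derivatives, to which [Ck_on] and the symmetry of second derivatives apply directly. *)
Definition omega_comp (a b : 'I_(d + d)) (z : 'rV[R]_(d + d)) : R :=
  'D_(delta_mx 0 b) (theta_comp a) z - 'D_(delta_mx 0 a) (theta_comp b) z.

Lemma omega_delta a b z : Ck_on 2 U E -> U z ->
  omega E z (delta_mx 0 a) (delta_mx 0 b) = omega_comp a b z.
Proof.
move=> CE Uz.
have dth c : differentiable (theta E c) z := (Ck_theta c oU CE).1 z Uz.
have D a' b' : 'D_(delta_mx 0 b') (theta_comp a') z =
    \sum_c 'D_(delta_mx 0 b') (theta E c) z * lsubmx
      (delta_mx 0 a' : 'rV[R]_(d + d)) 0 c.
  apply: etrans (derive_sumM _ (fun c => differentiable_cst (_ : R) z) dth) _.
  apply: eq_bigr => c _.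
  by rewrite derive_cst mulr0 addr0 mulrC.
rewrite /omega sumrB;
  exact: (f_equal2 (fun s t => s - t) (esym (D a b)) (esym (D b a))).
Qed.

Lemma Ck_omega_comp (k : nat) a b : Ck_on k.+2 U E ->
  Ck_on k U (omega_comp a b).
Proof.
move=> CE.
have Cm : Ck_on k U (fun z => -1 * 'D_(delta_mx 0 a) (theta_comp b) z).
  by apply: Ck_on_M => //; [exact: Ck_on_cst|exact: (Ck_theta_comp b CE).2].
apply: Ck_on_ext (Ck_on_D oU ((Ck_theta_comp a CE).2 b) Cm) => // z _.
by rewrite mulN1r.
Qed.

(** The identity [d (d theta) = 0]: six second derivatives cancel in pairs. Class C^3 of [E] makes
    the components of [theta] of class C^2. *)
Lemma omega_comp_closed a b c z : Ck_on 3 U E -> U z ->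
  'D_(delta_mx 0 a) (omega_comp b c) z + 'D_(delta_mx 0 b) (omega_comp c a) z +
  'D_(delta_mx 0 c) (omega_comp a b) z = 0.
Proof.
move=> CE Uz.
have dD a' b' (v : 'rV[R]_(d + d)) : derivable
  ('D_(delta_mx 0 b') (theta_comp a')) z v.
  exact: diff_derivable (((Ck_theta_comp a' CE).2 b').1 z Uz).
have D a' b' c' : 'D_(delta_mx 0 a') (omega_comp b' c') z =
    'D_(delta_mx 0 a') ('D_(delta_mx 0 c') (theta_comp b')) z -
    'D_(delta_mx 0 a') ('D_(delta_mx 0 b') (theta_comp c')) z.
  exact: deriveB (dD b' c' _) (dD c' b' _).
have DC a' b' c' := Ck_on_derive_comm a' b' oU Uz (Ck_theta_comp c' CE).
have alg (s1 s2 s3 t1 t2 t3 u1 u2 u3 : R) :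
    u1 = s1 - t1 -> u2 = s2 - t2 -> u3 = s3 - t3 ->
    t1 = s2 -> t2 = s3 -> t3 = s1 -> u1 + u2 + u3 = 0.
  by move=> -> -> -> -> -> ->; ring.
exact: alg (D a b c) (D b c a) (D c a b) (DC a b c) (DC b c a) (DC c a b).
Qed.

End ExteriorDerivative.

(** * From the preferred charts to a fixed chart *)

Section AlmostKahler.
Variables (F : TA -> R) (S : set TA).
Hypothesis oS : forall i, open (@chart_image R TA i S).
Hypothesis sqF_smooth : forall i, smooth_on (@chart_image R TA i S) (sqF F i).
Hypothesis fundamental_unit : forall i z, @chart_image R TA i S z ->
  fundamental F i z \in unitmx.

Let w : tensor2 TA := fun q X Y =>
  sasaki_matsumoto F q X (complex_structure F q Y).

Lemma coord_chart_image i q : S q -> dom i q.1 ->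
  @chart_image R TA i S (@Defs.coord R TA i q).
Proof. by move=> Sq iq; exists q. Qed.

Lemma fundamental_form_pref q X Y : S q ->
  w q X Y = omega (sqF F (pref q.1)) (@Defs.coord R TA (pref q.1) q) X Y.
Proof.
move=> Sq; apply: etrans (fundamental_formE F q X Y) _.
apply: (fundamental_form_omega (@oS (pref q.1)) (sqF_smooth (pref q.1) 3)).
  exact: fundamental_unit.
by apply: coord_chart_image => //; exact: Acover.
Qed.

(** At each [x] the preferred chart [j] of the base point is frozen, and [omega_pullback] along the
    transition from [i] to [j] carries the value at that point back to the chart [i]. The result no
    longer mentions [j], so it holds on the whole chart image and can be differentiated there. *)
Lemma fundamental_form_comp i (a b : 'I_(d + d)) (x : 'rV[R]_(d + d)) :
  @chart_image R TA i S x ->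
  tensor2_comp w i a b x = omega_comp (sqF F i) a b x.
Proof.
move=> Sx; have /tangent_chart_imageP[iix Sq] := Sx.
pose j := pref (param i (lsubmx x)).
pose T := @transition R TA i j.
have Wx : chart_image i (dom j) (lsubmx x).
  by have /chart_imageP[ix _ <-] := iix; exact: chart_image_pref.
apply: etrans (fundamental_form_pref _ _ Sq) _.
rewrite -(omega_delta (@oS i) a b (sqF_smooth i 2) Sx).
(* Over the overlap with [j], both local expressions of [F^2] evaluate [F] at the same tangent
   vector. *)
pose U1 := @chart_image R TA i S `&` lsubmx @^-1` (chart_image i (dom j)).
symmetry; apply: (@omega_pullback _ _ (transition i j) T
  (chart_image i (dom j)) _ _ _ U1
  (@chart_image R TA j S)).
- exact: Aoverlap.
- exact: (Atransition i j 2).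
- by move=> z; exact: tangent_transitionE.
- apply: openI; first exact: oS.
  by apply: open_comp (@Aoverlap _ _) => z _; exact: continuous_lsubmx.
- by move=> z [].
- move=> z [/tangent_chart_imageP[_ Sz] /chart_imageP[_ jz _]].
  by apply: coord_chart_image.
- move=> z; rewrite inE => -[_ /chart_imageP[_ jz _]].
  rewrite /sqF; have -> // : @param R TA j (T z) = @param R TA i z.
  exact: tangent_paramK.
- exact: (sqF_smooth j 2).
- by [].
Qed.

Lemma almost_kahler_of_smooth_sqF :
  almost_kahler S (sasaki_matsumoto F) (complex_structure F).
Proof.
split; first by move=> X Y _ _ q _; exact: sasaki_matsumoto_hermitian.
split; [split|].
- move=> q Sq t X X' Y; rewrite -!/(w q _ _) !fundamental_form_pref //.
  have /coord_chart_image /(_ (Acover q.1)) Uz := Sq.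
  have dth c : differentiable (theta (sqF F (pref q.1)) c)
    (@Defs.coord R TA (pref q.1) q).
    exact: (Ck_theta c (@oS (pref q.1)) (sqF_smooth (pref q.1) 2)).1.
  exact: omega_linear.
- move=> q Sq X Y; rewrite -!/(w q _ _) !fundamental_form_pref //.
  exact: omega_antisym.
- move=> i a b k; have CE := Ck_omega_comp (@oS i) a b (sqF_smooth i k.+2).
  by apply: Ck_on_ext CE => // x Ux; rewrite fundamental_form_comp.
- move=> i a b c x Ux.
  have D a' b' c' : 'D_(delta_mx 0 a') (tensor2_comp w i b' c') x =
      'D_(delta_mx 0 a') (omega_comp (sqF F i) b' c') x.
    apply: near_eq_derive; apply: (open_near (@oS i) Ux) => y Uy.
    exact: fundamental_form_comp.
  apply: etrans (omega_comp_closed (@oS i) a b c (sqF_smooth i 3) Ux).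
  exact: (f_equal2 +%R (f_equal2 +%R (D a b c) (D b c a)) (D c a b)).
Qed.

End AlmostKahler.
End TangentAtlas.

(** * Vertical Hessians and slit charts *)

Lemma quadratic_form0 (R : pzRingType) n (g : 'I_n -> 'I_n -> R) :
  \sum_a \sum_b g a b * ((0 : 'rV[R]_n) 0 a * (0 : 'rV[R]_n) 0 b) = 0.
Proof.
by rewrite big1 // => a _; rewrite big1 // => b _; rewrite mxE mul0r mulr0.
Qed.

(** A nonzero [u] with [u *m g = 0] would make the quadratic form vanish at [u]. *)
Lemma posdef_unitmx (R : realFieldType) n (g : 'M[R]_n) :
  (forall u : 'rV[R]_n, u != 0 -> 0 < \sum_a \sum_b g a b * (u 0 a * u 0 b)) ->
  g \in unitmx.
Proof.
move=> gpos; rewrite -row_free_unit -kermx_eq0;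
  apply: contraT => /rowV0Pn[u /sub_kermxP ug u0].
have := gpos u u0; rewrite exchange_big big1 ?ltxx // => b _.
transitivity ((u *m g) 0 b * u 0 b); last by rewrite ug mxE mul0r.
by rewrite mxE mulr_suml; apply: eq_bigr => a _; ring.
Qed.

Section VerticalHessian.
Variables (R : realType) (A : atlas R) (F : tangent A -> R) (i : Defs.index A).
Local Notation d := (Defs.dim A).

Lemma derive_vertical (E : 'rV[R]_(d + d) -> R) z (u : 'rV[R]_d) :
  differentiable E z -> 'D_(row_mx 0 u) E z = \sum_a u 0 a * 'D_(dy a) E z.
Proof.
move=> dE; apply: etrans (derive_dx_dy _ dE) _.
have l0 a : lsubmx (row_mx (0 : 'rV[R]_d) u) 0 a = 0 by rewrite row_mxKl mxE.
have ru a : rsubmx (row_mx (0 : 'rV[R]_d) u) 0 a = u 0 a by rewrite row_mxKr.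
rewrite -[RHS]add0r; apply: (f_equal2 +%R).
  by apply: big1 => a _; exact: etrans (f_equal ( *%R^~ _) (l0 a)) (mul0r _).
apply: eq_bigr => a _.
exact: (f_equal ( *%R^~ _) (ru a)).
Qed.

(** Replaces the matrix by a second directional derivative, which can be computed on the product
    without splitting indices. The factor 2 undoes the [2^-1] in [fundamental]. *)
Lemma vertical_hessian (U : set 'rV[R]_(d + d)) z (u : 'rV[R]_d) :
  open U -> Ck_on 2 U (sqF F i) -> U z ->
  'D_(row_mx 0 u) ('D_(row_mx 0 u) (sqF F i)) z =
  2 * \sum_a \sum_b fundamental F i z a b * (u 0 a * u 0 b).
Proof.
move=> oU CE Uz.
have dE y : U y -> 'D_(row_mx 0 u) (sqF F i) y =
  \sum_b u 0 b * 'D_(dy b) (sqF F i) y.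
  by move=> Uy; exact: derive_vertical (CE.1 _ Uy).
have dDE b : differentiable ('D_(dy b) (sqF F i)) z := (Ck_dy b CE).1 z Uz.
rewrite (near_eq_derive _ (open_near oU Uz dE)).
apply: etrans (derive_sumM _ (fun b => differentiable_cst (u 0 b) z) dDE) _.
rewrite exchange_big mulr_sumr; apply: eq_bigr => b _.
rewrite derive_cst mulr0 addr0.
apply: etrans (f_equal ( *%R (u 0 b)) (derive_vertical _ (dDE b))) _.
rewrite !mulr_sumr; apply: eq_bigr => a _; rewrite mxE.
by move: ('D_(dy a) _ _) => k; field.
Qed.

End VerticalHessian.

Lemma slit_chart_imageP (R : realType) (A : atlas R) (i : Defs.index A) z :
  is_manifold A ->
  @chart_image R (tangent A) i (slit A) z <->
  chart_image i (dom i) (lsubmx z) /\ rsubmx z != 0.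
Proof.
move=> [Ac Ap Ao At _ _]; split.
  move=> /(tangent_chart_imageP Ac Ap Ao At)[iiz]; rewrite /slit /=.
  by rewrite (tangent_vec_eq0 Ac Ap Ao At).
move=> [iiz rz]; apply/(tangent_chart_imageP Ac Ap Ao At); split=> //.
by rewrite /slit /= (tangent_vec_eq0 Ac Ap Ao At).
Qed.

(** * Product atlases *)

Section ProductAtlas.
Variables (R : realType) (M1 M2 : atlas R).
Hypotheses (hM1 : is_manifold M1) (hM2 : is_manifold M2).
Local Notation M := (Defs.product M1 M2).
Local Notation d1 := (Defs.dim M1).
Local Notation d2 := (Defs.dim M2).
Implicit Types (i j : Defs.index M) (x u v : 'rV[R]_(d1 + d2)).

Let linear_lsubmx : linear (lsubmx : 'rV[R]_(d1 + d2) -> 'rV[R]_d1).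
Proof. exact: linearP. Qed.

Let linear_rsubmx : linear (rsubmx : 'rV[R]_(d1 + d2) -> 'rV[R]_d2).
Proof. exact: linearP. Qed.

Lemma product_chart_imageP i j x :
  chart_image i (dom j) x <->
  chart_image i.1 (dom j.1) (lsubmx x) /\ chart_image i.2 (dom j.2) (rsubmx x).
Proof.
split=> [[p [[ip1 ip2] [jp1 jp2]] <-] | [[p1 [ip1 jp1] E1] [p2 [ip2 jp2] E2]]].
  rewrite /= row_mxKl row_mxKr.
  by split; [exists p.1 | exists p.2].
exists (p1, p2); first by split; split.
by rewrite /= E1 E2 hsubmxK.
Qed.

Lemma product_cover (p : M) : dom (pref p) p.
Proof. by split; apply: manifold_cover. Qed.

Lemma product_paramK i (p : M) : dom i p -> param i (Defs.coord i p) = p.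
Proof.
move=> [ip1 ip2]; rewrite /= row_mxKl row_mxKr.
by rewrite (manifold_paramK hM1 ip1) (manifold_paramK hM2 ip2); case: p ip1 ip2.
Qed.

Lemma product_overlap i j : open (chart_image i (dom j)).
Proof.
have -> : chart_image i (dom j) =
    lsubmx @^-1` chart_image i.1 (dom j.1) `&`
    rsubmx @^-1` chart_image i.2 (dom j.2).
  by apply/seteqP; split=> x /product_chart_imageP.
apply: openI.
  have o1 : open (chart_image i.1 (dom j.1)) by exact: manifold_overlap.
  by apply: open_comp o1 => z _; exact: continuous_lsubmx.
have o2 : open (chart_image i.2 (dom j.2)) by exact: manifold_overlap.
by apply: open_comp o2 => z _; exact: continuous_rsubmx.
Qed.

Lemma product_transition_smooth i j :
  smooth_on (chart_image i (dom j)) (transition i j).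
Proof.
move=> k; have oij := @product_overlap i j; apply: Ck_on_rV => // b.
rewrite -[b]fintype.splitK; case: (fintype.split b) => c /=.
  have C := Ck_on_coord c (@manifold_overlap _ _ hM1 i.1 j.1)
    (@manifold_transition _ _ hM1 i.1 j.1 k).
  have {}C := Ck_on_comp_linear (@manifold_overlap _ _ hM1 i.1 j.1)
    linear_lsubmx C.
  have sub : chart_image i (dom j) `<=` lsubmx @^-1`
    (chart_image i.1 (dom j.1)).
    by move=> x /product_chart_imageP[].
  apply: Ck_on_ext (Ck_on_subset sub C) => // x _.
  by rewrite /transition /= row_mxEl.
have C := Ck_on_coord c (@manifold_overlap _ _ hM2 i.2 j.2)
  (@manifold_transition _ _ hM2 i.2 j.2 k).
have {}C := Ck_on_comp_linear (@manifold_overlap _ _ hM2 i.2 j.2) linear_rsubmx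
  C.
have sub : chart_image i (dom j) `<=` rsubmx @^-1` (chart_image i.2 (dom j.2)).
  by move=> x /product_chart_imageP[].
apply: Ck_on_ext (Ck_on_subset sub C) => // x _.
by rewrite /transition /= row_mxEr.
Qed.

Lemma diff_product_transition i j x v : chart_image i (dom j) x ->
  'd (transition i j) x v =
  row_mx ('d (transition i.1 j.1) (lsubmx x) (lsubmx v))
         ('d (transition i.2 j.2) (rsubmx x) (rsubmx v)).
Proof.
move=> ijx; have /product_chart_imageP[ij1 ij2] := ijx.
have dt := (@product_transition_smooth i j 1).1 _ ijx.
have dt1 := (@manifold_transition _ _ hM1 i.1 j.1 1).1 _ ij1.
have dt2 := (@manifold_transition _ _ hM2 i.2 j.2 1).1 _ ij2.
rewrite -(deriveE _ dt) -(deriveE _ dt1) -(deriveE _ dt2).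
apply/rowP => b; rewrite -(derive_coord _ _ dt) -[b]fintype.splitK.
case: (fintype.split b) => c /=.
  rewrite row_mxEl -(derive_coord _ _ dt1).
  rewrite -(derive_comp_linear _ linear_lsubmx
    (differentiable_comp_coord c dt1)).
  by apply: f_equal3 => //; apply/funext => y; rewrite /transition /= row_mxEl.
rewrite row_mxEr -(derive_coord _ _ dt2).
rewrite -(derive_comp_linear _ linear_rsubmx (differentiable_comp_coord c dt2)).
by apply: f_equal3 => //; apply/funext => y; rewrite /transition /= row_mxEr.
Qed.

End ProductAtlas.

(** * Doubly warped products *)

Section BaseTimesFibre.
Variables (R : realType) (n m p : nat).
Variables (B : 'rV[R]_n -> 'rV[R]_p) (L : 'rV[R]_n -> 'rV[R]_m).
Hypotheses (linB : linear B) (linL : linear L).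
Variables (h : 'rV[R]_p -> R).
Variables (V : set 'rV[R]_p) (U : set 'rV[R]_m) (Z : set 'rV[R]_n).
Hypotheses (oV : open V) (oU : open U) (oZ : open Z).
Hypotheses (ZV : Z `<=` B @^-1` V) (ZU : Z `<=` L @^-1` U).
Implicit Types (G : 'rV[R]_m -> R).

(** In the application [B] reads the base coordinates of one factor, whose warping function enters
    through [h], and [L] reads the induced coordinates of the tangent bundle of the other. The
    condition [B u = 0] below then holds for vertical [u]. *)
Lemma Ck_on_base_times_fibre k G : Ck_on k V h -> Ck_on k U G ->
  Ck_on k Z (fun z => h (B z) * G (L z)).
Proof.
move=> Ch CG; apply: Ck_on_M => //.
  exact: Ck_on_subset ZV (Ck_on_comp_linear oV linB Ch).
exact: Ck_on_subset ZU (Ck_on_comp_linear oU linL CG).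
Qed.

Lemma derive_base_times_fibre G z u : Ck_on 1 V h -> Ck_on 1 U G -> Z z ->
  B u = 0 ->
  'D_u (fun y => h (B y) * G (L y)) z = h (B z) * 'D_(L u) G (L z).
Proof.
move=> Ch CG Zz Bu.
have dh : differentiable h (B z) by exact: Ch.1 (ZV Zz).
have dG : differentiable G (L z) by exact: CG.1 (ZU Zz).
have dhB := differentiable_comp (differentiable_linear_rV z linB) dh.
have dGL := differentiable_comp (differentiable_linear_rV z linL) dG.
apply: etrans (deriveM (diff_derivable dhB) (diff_derivable dGL)) _.
rewrite (derive_comp_linear _ linB dh) (derive_comp_linear _ linL dG).
rewrite Bu derive0 scaler0; exact: addr0.
Qed.

Lemma derive2_base_times_fibre G z u : Ck_on 1 V h -> Ck_on 2 U G -> Z z ->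
  B u = 0 ->
  'D_u ('D_u (fun y => h (B y) * G (L y))) z = h (B z) * 'D_(L u) ('D_(L u) G)
    (L z).
Proof.
move=> Ch CG Zz Bu.
have D y : Z y -> 'D_u (fun y => h (B y) * G (L y)) y =
  h (B y) * 'D_(L u) G (L y).
  by move=> Zy; exact: derive_base_times_fibre Ch (Ck_onW CG) Zy Bu.
rewrite (near_eq_derive _ (open_near oZ Zz D)).
exact: derive_base_times_fibre Ch (Ck_on_derive _ oU CG) Zz Bu.
Qed.

End BaseTimesFibre.

Lemma derive2_D (R : realType) n (Z : set 'rV[R]_n) (f h : 'rV[R]_n -> R) z u :
  open Z -> Ck_on 2 Z f -> Ck_on 2 Z h -> Z z ->
  'D_u ('D_u (fun y => f y + h y)) z = 'D_u ('D_u f) z + 'D_u ('D_u h) z.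
Proof.
move=> oZ Cf Ch Zz.
have D y : Z y -> 'D_u (fun y => f y + h y) y = 'D_u f y + 'D_u h y.
  by move=> Zy; exact: deriveD (diff_derivable (Cf.1 _ Zy))
    (diff_derivable (Ch.1 _ Zy)).
rewrite (near_eq_derive _ (open_near oZ Zz D)).
exact: deriveD (diff_derivable ((Ck_on_derive u oZ Cf).1 _ Zz))
               (diff_derivable ((Ck_on_derive u oZ Ch).1 _ Zz)).
Qed.

Lemma open_setT_chart (R : realType) (A : atlas R) (j : Defs.index A) :
  is_manifold A -> open (chart_image j (setT : set A)).
Proof.
move=> hA.
have -> : chart_image j setT = chart_image j (dom j).
  by apply/seteqP; split=> x [p [jp _] <-]; exists p.
exact: manifold_overlap.
Qed.

Lemma open_slit_chart (R : realType) (A : atlas R) (i : Defs.index A) :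
  is_manifold A -> open (@chart_image R (tangent A) i (slit A)).
Proof.
move=> hA.
have -> : @chart_image R (tangent A) i (slit A) =
    lsubmx @^-1` chart_image i (dom i) `&` rsubmx @^-1` [set~ 0].
  apply/seteqP; split=> z.
    by move=> /(slit_chart_imageP _ _ hA)[iz /eqP z0].
  by move=> [iz /eqP z0]; apply/(slit_chart_imageP _ _ hA).
have o1 : open (chart_image i (dom i)) by exact: manifold_overlap.
have o2 : open [set~ (0 : 'rV[R]_(Defs.dim A))].
  by rewrite openC;
    exact: accessible_closed_set1 (hausdorff_accessible (@norm_hausdorff _ _))
      _.
apply: openI.
  by apply: open_comp o1 => z _; exact: continuous_lsubmx.
by apply: open_comp o2 => z _; exact: continuous_rsubmx.
Qed.

Lemma sqF_smooth (R : realType) (A : atlas R) (F : tangent A -> R)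
    (i : Defs.index A) :
  is_manifold A -> is_finsler F ->
  smooth_on (@chart_image R (tangent A) i (slit A)) (sqF F i).
Proof.
move=> hA [_ Fs _ _] k; have oS := @open_slit_chart _ _ i hA; have C := Fs i k.
by apply: Ck_on_ext (Ck_on_M oS C C) => // z _; rewrite /sqF expr2.
Qed.

Section DoublyWarped.
Variables (R : realType) (M1 M2 : atlas R).
Hypotheses (hM1 : is_manifold M1) (hM2 : is_manifold M2).
Variables (F1 : tangent M1 -> R) (F2 : tangent M2 -> R).
Hypotheses (hF1 : is_finsler F1) (hF2 : is_finsler F2).
Variables (f1 : M1 -> R) (f2 : M2 -> R).
Hypotheses (hf1 : smooth_fun setT f1) (hf2 : smooth_fun setT f2).
Hypotheses (f1_gt0 : forall p, 0 < f1 p) (f2_gt0 : forall p, 0 < f2 p).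
Local Notation M := (Defs.product M1 M2).
Local Notation d1 := (Defs.dim M1).
Local Notation d2 := (Defs.dim M2).
Local Notation F := (doubly_warped F1 F2 f1 f2).
Local Notation S := (slit_product M1 M2).
Implicit Types (i : Defs.index M) (z : 'rV[R]_((d1 + d2) + (d1 + d2))).

(** Induced coordinates on the product come in the order [(x1, x2, y1, y2)]; [part1] and [part2]
    regroup them as [(x1, y1)] and [(x2, y2)]. *)
Let base1 z : 'rV[R]_d1 := lsubmx (lsubmx z).
Let base2 z : 'rV[R]_d2 := rsubmx (lsubmx z).
Let part1 z : 'rV[R]_(d1 + d1) := row_mx (base1 z) (lsubmx (rsubmx z)).
Let part2 z : 'rV[R]_(d2 + d2) := row_mx (base2 z) (rsubmx (rsubmx z)).

Let linear_base1 : linear base1.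
Proof. by move=> t z z'; rewrite /base1 !linearP. Qed.

Let linear_base2 : linear base2.
Proof. by move=> t z z'; rewrite /base2 !linearP. Qed.

Let linear_part1 : linear part1.
Proof.
by move=> t z z'; rewrite /part1 linear_base1 !linearP scale_row_mx add_row_mx.
Qed.

Let linear_part2 : linear part2.
Proof.
by move=> t z z'; rewrite /part2 linear_base2 !linearP scale_row_mx add_row_mx.
Qed.

Let Mcover := product_cover hM1 hM2.
Let MparamK := product_paramK hM1 hM2.
Let Moverlap := @product_overlap _ _ _ hM1 hM2.
Let Mtransition := @product_transition_smooth _ _ _ hM1 hM2.

Lemma product_param i z : chart_image i (dom i) (lsubmx z) ->
  @param R (tangent M) i z =
  ((param i.1 (base1 z), param i.2 (base2 z)),
   row_mx (tangent_vec i.1 (base1 z) (lsubmx (rsubmx z)))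
          (tangent_vec i.2 (base2 z) (rsubmx (rsubmx z)))).
Proof.
move=> iiz; have /(chart_imageP MparamK)[iz _ zE] := iiz.
rewrite /= /tangent_vec diff_product_transition //.
by rewrite -{2}zE; exact: chart_image_pref.
Qed.

(** Places [part1 z] and [part2 z] in the slit bundles of the factors, where the smoothness and the
    convexity of [F1] and [F2] are available. *)
Lemma slit_product_chart_imageP i z :
  @chart_image R (tangent M) i S z <->
  @chart_image R (tangent M1) i.1 (slit M1) (part1 z) /\
  @chart_image R (tangent M2) i.2 (slit M2) (part2 z).
Proof.
have [A1 B1 C1 D1 _ _] := hM1; have [A2 B2 C2 D2 _ _] := hM2.
split.
  move=> /(tangent_chart_imageP Mcover MparamK Moverlap Mtransition)[iiz].
  rewrite (product_param iiz) /slit_product /= row_mxKl row_mxKr.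
  have /product_chart_imageP[i1 i2] := iiz.
  rewrite (tangent_vec_eq0 A1 B1 C1 D1) // (tangent_vec_eq0 A2 B2 C2 D2)
    // => -[y1 y2].
  by split; apply/slit_chart_imageP => //; rewrite row_mxKl row_mxKr.
move=> [/(slit_chart_imageP _ _ hM1)[]]; rewrite row_mxKl row_mxKr => i1 y1.
move=> /(slit_chart_imageP _ _ hM2)[]; rewrite row_mxKl row_mxKr => i2 y2.
have iiz : chart_image i (dom i) (lsubmx z) by apply/product_chart_imageP.
apply/(tangent_chart_imageP Mcover MparamK Moverlap Mtransition); split=> //.
rewrite (product_param iiz) /slit_product /= row_mxKl row_mxKr.
by rewrite (tangent_vec_eq0 A1 B1 C1 D1) // (tangent_vec_eq0 A2 B2 C2 D2).
Qed.

Let h1 i (x : 'rV[R]_d1) : R := f1 (param i.1 x) ^+ 2.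
Let h2 i (x : 'rV[R]_d2) : R := f2 (param i.2 x) ^+ 2.
Let E1 i := sqF F1 i.1.
Let E2 i := sqF F2 i.2.
Let V1 i := chart_image i.1 (setT : set M1).
Let V2 i := chart_image i.2 (setT : set M2).
Let U1 i := @chart_image R (tangent M1) i.1 (slit M1).
Let U2 i := @chart_image R (tangent M2) i.2 (slit M2).
Let Z i := @chart_image R (tangent M) i S.

Let oV1 i : open (V1 i). Proof. exact: open_setT_chart. Qed.
Let oV2 i : open (V2 i). Proof. exact: open_setT_chart. Qed.
Let oU1 i : open (U1 i). Proof. exact: open_slit_chart. Qed.
Let oU2 i : open (U2 i). Proof. exact: open_slit_chart. Qed.

Lemma open_slit_product_chart i : open (Z i).
Proof.
have -> : Z i = part1 @^-1` U1 i `&` part2 @^-1` U2 i.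
  by apply/seteqP; split=> z /slit_product_chart_imageP.
apply: openI.
  apply: open_comp (@oU1 i) => z _.
  exact: differentiable_continuous (differentiable_linear_rV z linear_part1).
apply: open_comp (@oU2 i) => z _.
exact: differentiable_continuous (differentiable_linear_rV z linear_part2).
Qed.

Let ZU1 i : Z i `<=` part1 @^-1` U1 i.
Proof. by move=> z /slit_product_chart_imageP[]. Qed.

Let ZU2 i : Z i `<=` part2 @^-1` U2 i.
Proof. by move=> z /slit_product_chart_imageP[]. Qed.

Let ZV1 i : Z i `<=` base1 @^-1` V1 i.
Proof.
move=> z /ZU1 /(slit_chart_imageP _ _ hM1)[[p [ip _] zE] _]; exists p => //.
by rewrite zE row_mxKl.
Qed.

Let ZV2 i : Z i `<=` base2 @^-1` V2 i.
Proof.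
move=> z /ZU2 /(slit_chart_imageP _ _ hM2)[[p [ip _] zE] _]; exists p => //.
by rewrite zE row_mxKl.
Qed.

Let Ch1 i : smooth_on (V1 i) (h1 i).
Proof.
move=> k; have C := hf1 i.1 k.
by apply: Ck_on_ext (Ck_on_M (@oV1 i) C C) => // x _; rewrite /h1 expr2.
Qed.

Let Ch2 i : smooth_on (V2 i) (h2 i).
Proof.
move=> k; have C := hf2 i.2 k.
by apply: Ck_on_ext (Ck_on_M (@oV2 i) C C) => // x _; rewrite /h2 expr2.
Qed.

Let CE1 i : smooth_on (U1 i) (E1 i). Proof. exact: sqF_smooth. Qed.
Let CE2 i : smooth_on (U2 i) (E2 i). Proof. exact: sqF_smooth. Qed.

Let T1 i z : R := h2 i (base2 z) * E1 i (part1 z).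
Let T2 i z : R := h1 i (base1 z) * E2 i (part2 z).

Let CT1 i : smooth_on (Z i) (T1 i).
Proof.
move=> k; exact: (Ck_on_base_times_fibre linear_base2 linear_part1 (@oV2 i)
  (@oU1 i) (@open_slit_product_chart i)
  (@ZV2 i) (@ZU1 i) (@Ch2 i k) (@CE1 i k)).
Qed.

Let CT2 i : smooth_on (Z i) (T2 i).
Proof.
move=> k; exact: (Ck_on_base_times_fibre linear_base1 linear_part2 (@oV1 i)
  (@oU2 i) (@open_slit_product_chart i)
  (@ZV1 i) (@ZU2 i) (@Ch1 i k) (@CE2 i k)).
Qed.

Lemma sqF_doubly_warped i z : Z i z -> sqF F i z = T1 i z + T2 i z.
Proof.
move=> /(tangent_chart_imageP Mcover MparamK Moverlap Mtransition)[iiz _].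
rewrite {1}/sqF product_param // /doubly_warped /= row_mxKl row_mxKr sqr_sqrtr.
  by rewrite /T1 /T2 /h1 /h2 /E1 /E2 /sqF /= !row_mxKl !row_mxKr.
by rewrite addr_ge0 // mulr_ge0 // sqr_ge0.
Qed.

Lemma sqF_doubly_warped_smooth i : smooth_on (Z i) (sqF F i).
Proof.
move=> k; have oZ := @open_slit_product_chart i.
apply: (Ck_on_ext oZ _ (Ck_on_D oZ (@CT1 i k) (@CT2 i k))) => z Zz.
by rewrite sqF_doubly_warped.
Qed.

(** The warping factors are constant along the fibres, so that the vertical
    Hessian of [F ^ 2] splits. *)
Lemma fundamental_doubly_warped i z (v : 'rV[R]_(d1 + d2)) : Z i z ->
  \sum_a \sum_b fundamental F i z a b * (v 0 a * v 0 b) =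
  h2 i (base2 z) * (\sum_a \sum_b
    fundamental F1 i.1 (part1 z) a b * (lsubmx v 0 a * lsubmx v 0 b)) +
  h1 i (base1 z) * (\sum_a \sum_b
    fundamental F2 i.2 (part2 z) a b * (rsubmx v 0 a * rsubmx v 0 b)).
Proof.
move=> Zz; pose u : 'rV[R]_((d1 + d2) + (d1 + d2)) := row_mx 0 v.
have b1 : base1 u = 0 by rewrite /base1 row_mxKl linear0.
have b2 : base2 u = 0 by rewrite /base2 row_mxKl linear0.
have p1 : part1 u = row_mx 0 (lsubmx v) by rewrite /part1 b1 row_mxKr.
have p2 : part2 u = row_mx 0 (rsubmx v) by rewrite /part2 b2 row_mxKr.
have H : 'D_u ('D_u (sqF F i)) z = 'D_u ('D_u (T1 i)) z + 'D_u ('D_u (T2 i)) z.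
  rewrite -(derive2_D u (@open_slit_product_chart i) (@CT1 i 2) (@CT2 i 2) Zz).
  (* The formula for [F^2] holds only on [Z i], so each of the two derivatives needs a neighbourhood
     of its own point. *)
  apply: near_eq_derive;
    apply: (open_near (@open_slit_product_chart i) Zz) => y Zy.
  apply: near_eq_derive;
    apply: (open_near (@open_slit_product_chart i) Zy) => y' Zy'.
  exact: sqF_doubly_warped.
have H0 := @vertical_hessian R M F i (Z i) z v (@open_slit_product_chart i)
  (@sqF_doubly_warped_smooth i 2) Zz.
have H1 : 'D_u ('D_u (T1 i)) z = h2 i (base2 z) * 'D_(part1 u)
  ('D_(part1 u) (E1 i)) (part1 z).
  exact: (derive2_base_times_fibre linear_base2 linear_part1 (@oU1 i)
    (@open_slit_product_chart i)
    (@ZV2 i) (@ZU1 i) (@Ch2 i 1) (@CE1 i 2) Zz b2).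
have H2 : 'D_u ('D_u (T2 i)) z = h1 i (base1 z) * 'D_(part2 u)
  ('D_(part2 u) (E2 i)) (part2 z).
  exact: (derive2_base_times_fibre linear_base1 linear_part2 (@oU2 i)
    (@open_slit_product_chart i)
    (@ZV1 i) (@ZU2 i) (@Ch1 i 1) (@CE2 i 2) Zz b1).
rewrite p1 in H1; rewrite p2 in H2.
have H1' := @vertical_hessian R M1 F1 i.1 (U1 i) (part1 z) (lsubmx v) (@oU1 i)
  (@CE1 i 2) (ZU1 Zz).
have H2' := @vertical_hessian R M2 F2 i.2 (U2 i) (part2 z) (rsubmx v) (@oU2 i)
  (@CE2 i 2) (ZU2 Zz).
have alg (a b c q q1 q2 x y k1 k2 : R) : a = 2 * q -> a = b + c -> b =
  k1 * x -> c = k2 * y ->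
    x = 2 * q1 -> y = 2 * q2 -> q = k1 * q1 + k2 * q2.
  move=> ea e eb ec ex ey; have two0 : (2 : R) != 0 by rewrite pnatr_eq0.
  by apply: (mulfI two0); rewrite -ea e eb ec ex ey; ring.
exact: alg H0 H H1 H2 H1' H2'.
Qed.

Lemma fundamental_doubly_warped_unit i z : Z i z ->
  fundamental F i z \in unitmx.
Proof.
move=> Zz; apply: posdef_unitmx => v v0;
  rewrite (fundamental_doubly_warped v Zz).
have k1 : 0 < h2 i (base2 z) by rewrite exprn_gt0.
have k2 : 0 < h1 i (base1 z) by rewrite exprn_gt0.
(* Convexity of a factor speaks of nonzero vectors only, so a vanishing half of [v] is treated
   apart; not both halves vanish. *)
have [l0|l0] := eqVneq (lsubmx v) 0; have [r0|r0] := eqVneq (rsubmx v) 0.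
- by move: v0; rewrite -[v]hsubmxK l0 r0 row_mx0 eqxx.
- rewrite l0 quadratic_form0 mulr0 add0r mulr_gt0 //.
  exact: (finsler_convex hF2 (ZU2 Zz) r0).
- rewrite r0 quadratic_form0 mulr0 addr0 mulr_gt0 //.
  exact: (finsler_convex hF1 (ZU1 Zz) l0).
- rewrite addr_gt0 // mulr_gt0 //.
    exact: (finsler_convex hF1 (ZU1 Zz) l0).
  exact: (finsler_convex hF2 (ZU2 Zz) r0).
Qed.

End DoublyWarped.

Theorem theorem9 (R : realType) (M1 M2 : atlas R)
    (hM1 : is_manifold M1) (hM2 : is_manifold M2)
    (F1 : tangent M1 -> R) (F2 : tangent M2 -> R)
    (hF1 : is_finsler F1) (hF2 : is_finsler F2)
    (f1 : M1 -> R) (f2 : M2 -> R)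
    (hf1 : smooth_fun setT f1) (hf2 : smooth_fun setT f2)
    (f1_gt0 : forall p, 0 < f1 p) (f2_gt0 : forall p, 0 < f2 p) :
  almost_kahler (slit_product M1 M2)
    (sasaki_matsumoto (doubly_warped F1 F2 f1 f2))
    (complex_structure (doubly_warped F1 F2 f1 f2)).
Proof.
apply: almost_kahler_of_smooth_sqF.
- exact: product_cover.
- exact: product_paramK.
- exact: product_overlap.
- exact: product_transition_smooth.
- exact: open_slit_product_chart.
- exact: sqF_doubly_warped_smooth.
- exact: fundamental_doubly_warped_unit.
Qed.
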